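(* For all integers $p,k\geq 2$ and each $\bullet\in\{\mathrm{DSO},\mathrm{ODJM}\}$, $$\mathfrak{g}_\bullet(2kp)\geq \mathfrak{g}_\bullet(p)+(k-1)p.$$
   Context: Write $\mathbb{R}_+ = (0,\infty)$. For $a \in \mathbb{R}_+^p$ and $v \in \mathbb{R}^p$ (with $p\ge 2$), let $J_{a,v}(\theta)$, $\theta \in \mathbb{R}$, be the Hermitian $p\times p$ matrix with diagonal entries $v_1,\dots,v_p$, entries $a_1,\dots,a_{p-1}$ on the first super- and sub-diagonals (i.e. the $(j,j+1)$ and $(j+1,j)$ entries equal $a_j$ for $1\le j\le p-1$), $(1,p)$ entry $e^{-2\pi i \theta}a_p$, $(p,1)$ entry $e^{2\pi i\theta}a_p$, and all other entries zero; when $p=2$ the contributions to the same entry are added, so the $(1,2)$ entry is $a_1+e^{-2\pi i\theta}a_2$ and the $(2,1)$ entry is $a_1+e^{2\pi i\theta}a_2$. (These are the Floquet matrices of the periodic Jacobi matrix $[\mathbf{J}_{a,v}\psi](n) = A(n-1)\psi(n-1)+V(n)\psi(n)+A(n)\psi(n+1)$ on $\ell^2(\mathbb{Z})$, where $A,V$ are the $p$-periodic extensions of $a,v$.) Let $\lambda_1(\theta)\le\cdots\le\lambda_p(\theta)$ be the eigenvalues of $J_{a,v}(\theta)$ counted with multiplicity, and put $\lambda_j^- = \min_{\theta\in[0,1]}\lambda_j(\theta)$, $\lambda_j^+ = \max_{\theta\in[0,1]}\lambda_j(\theta)$. It is known that $\lambda_1^-<\lambda_1^+\le\lambda_2^-<\cdots\le\lambda_p^-<\lambda_p^+$.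 A number $\lambda\in\mathbb{R}$ is a closed gap of $(a,v)$ if $\lambda=\lambda_j^+=\lambda_{j+1}^-$ for some $1\le j\le p-1$. Let $\mathfrak{g}(a,v)$ be the number of closed gaps of $(a,v)$; put $\mathfrak{g}_{\mathrm{DSO}}(v)=\mathfrak{g}(\mathbf{1},v)$ for $v\in\mathbb{R}^p$, where $\mathbf{1}=(1,\dots,1)$, and $\mathfrak{g}_{\mathrm{ODJM}}(a)=\mathfrak{g}(a,\mathbf{0})$ for $a\in\mathbb{R}_+^p$, where $\mathbf{0}=(0,\dots,0)$. Let $\mathrm{cyc}(v_1,\dots,v_p)=(v_2,\dots,v_p,v_1)$. A vector $v \in \mathbb{R}^p$ is irreducible if $v,\mathrm{cyc}(v),\dots,\mathrm{cyc}^{p-1}(v)$ are pairwise distinct, and reducible otherwise. Define $\mathfrak{g}_{\mathrm{DSO}}(p)=\max\{\mathfrak{g}_{\mathrm{DSO}}(v): v\in\mathbb{R}^p \text{ irreducible}\}$ and $\mathfrak{g}_{\mathrm{ODJM}}(p)=\max\{\mathfrak{g}_{\mathrm{ODJM}}(a): a\in\mathbb{R}_+^p\text{ irreducible}\}$. *)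

(* Defs.v *)
From HB Require Import structures.
From mathcomp Require Import all_boot all_order all_algebra.
From mathcomp Require Import finmap.
From mathcomp Require Import all_classical all_reals all_analysis.
From mathcomp Require Import complex.

Set Implicit Arguments.
Unset Strict Implicit.
Unset Printing Implicit Defensive.

Import Order.TTheory GRing.Theory Num.Theory.

Local Open Scope classical_set_scope.
Local Open Scope ring_scope.
Local Open Scope complex_scope.

(* The greatest and the least element of A; the default x0 is returned only
   when A has none. *)
Definition set_max {d} {T : porderType d} (x0 : T) (A : set T) : T :=
  xget x0 [set m | A m /\ ubound A m].

Definition set_min {d} {T : porderType d} (x0 : T) (A : set T) : T :=
  xget x0 [set m | A m /\ lbound A m].

Section Floquet.
Variable R : realType.

(* exp (2 pi i theta) *)
Definition expi (theta : R) : R[i] :=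
  cos (2 * pi * theta) +i* sin (2 * pi * theta).

(* Indices start at 0, so the last coordinate of a is a 0 i with i = p.-1.
   The contributions are summed, which for p = 2 makes the off-diagonal and
   the corner terms add up in the same entry. *)
Definition floquet (p : nat) (a v : 'rV[R]_p) (theta : R) : 'M[R[i]]_p :=
  \matrix_(i < p, j < p)
    ((v 0 i)%:C *+ (i == j)
     + (a 0 i)%:C *+ (j == i.+1 :> nat)
     + (a 0 j)%:C *+ (i == j.+1 :> nat)
     + expi (- theta) * (a 0 j)%:C *+ ((i == 0%N :> nat) && (j == p.-1 :> nat))
     + expi theta * (a 0 i)%:C *+ ((i == p.-1 :> nat) && (j == 0%N :> nat))).

(* The roots of the characteristic polynomial, with multiplicity. *)
Definition spectrum (p : nat) (A : 'M[R[i]]_p) : seq R[i] :=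
  sval (closed_field_poly_normal (char_poly A)).

(* The spectrum of a Hermitian matrix is real: taking real parts only changes
   the type of the eigenvalues. *)
Definition eigenvals (p : nat) (A : 'M[R[i]]_p) : seq R :=
  sort <=%R [seq complex.Re z | z <- spectrum A].

(* lambda a v j theta is the (j+1)-st eigenvalue, for j < p. *)
Definition lambda (p : nat) (a v : 'rV[R]_p) (j : nat) (theta : R) : R :=
  (eigenvals (floquet a v theta))`_j.

Definition lambda_minus (p : nat) (a v : 'rV[R]_p) (j : nat) : R :=
  set_min 0 (lambda a v j @` `[0, 1]).

Definition lambda_plus (p : nat) (a v : 'rV[R]_p) (j : nat) : R :=
  set_max 0 (lambda a v j @` `[0, 1]).

Definition closed_gap (p : nat) (a v : 'rV[R]_p) (x : R) : Prop :=
  exists j : nat,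
    [/\ (j.+1 < p)%N, x = lambda_plus a v j & x = lambda_minus a v j.+1].

Definition num_closed_gaps (p : nat) (a v : 'rV[R]_p) : nat :=
  #|` fset_set [set x | closed_gap a v x] |.

Definition gDSO (p : nat) (v : 'rV[R]_p) : nat :=
  num_closed_gaps (const_mx 1) v.

Definition gODJM (p : nat) (a : 'rV[R]_p) : nat :=
  num_closed_gaps a (const_mx 0).

(* ordS j is j + 1 modulo p. *)
Definition cyc (p : nat) (v : 'rV[R]_p) : 'rV[R]_p := \row_j v 0 (ordS j).

Definition irreducible_vec (p : nat) (v : 'rV[R]_p) : Prop :=
  forall i j : 'I_p, iter i (@cyc p) v = iter j (@cyc p) v -> i = j.

Definition positive_vec (p : nat) (a : 'rV[R]_p) : Prop :=
  forall j : 'I_p, 0 < a 0 j.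

Definition max_gDSO (p : nat) : nat :=
  set_max 0%N [set gDSO v | v in [set v : 'rV[R]_p | irreducible_vec v]].

Definition max_gODJM (p : nat) : nat :=
  set_max 0%N [set gODJM a
    | a in [set a : 'rV[R]_p | positive_vec a /\ irreducible_vec a]].

End Floquet.

(* Main.v *)
Require Import Defs.
From mathcomp Require Import all_boot all_order all_algebra.
From mathcomp Require Import finmap.
From mathcomp Require Import all_classical all_reals all_analysis.
From mathcomp Require Import complex polyrcf lra ring zify.

(** Let v be irreducible of length p with the largest possible number of closed
    gaps, and let w be the word v^k followed by (cyc v)^k, of length 2kp (in the
    off-diagonal case the same is done with a).  All the closed gaps of v are
    closed gaps of w, and w has (k-1)p further ones.

    Transfer matrices.  A solution of the difference equation at energy x is
    carried from one site to the next by the 2 x 2 matrix [transfer], which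
    has determinant 1 and, with the state (a_(n-1) u_(n-1), u_n), depends on
    the coefficients of one site only; so the monodromy of a concatenation is
    the product of the monodromies.  Eigenvectors of the Floquet matrix are the
    orbits whose initial state is an eigenvector of the monodromy M over one
    period; its eigenspace is two-dimensional if and only if M is the scalar
    exp(-2 pi i theta), and then M = 1 or M = -1 since det M = 1
    ([monodromy_scalar], [scalar_monodromy_rank]).

    Closed gaps are double eigenvalues ([closed_gapP]).  Expanding along the two
    corners, char_poly (J theta) = P - K cos (2 pi theta) with P real and
    K = 2 a_1 ... a_p > 0 ([floquet_char_poly]).  As J theta is Hermitian, P - c
    is real-rooted for |c| <= K, and by the previous paragraph its roots are
    simple for |c| < K.  Hence the critical values of P lie outside ]-K, K[, the
    critical points of P separate the bands, and P runs monotonically through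
    [-K, K] on each band, alternately upwards and downwards ([band_edges]).
    The facing edges of two consecutive bands thus belong to the same value of
    theta, 0 or 1/2, and they coincide exactly at a double eigenvalue.

    Counting ([num_closed_gaps_shifted_repeat]).  Let M be the monodromy of v
    at x.  If M^k = e with e^2 = 1, then the monodromy of cyc v, being conjugate
    to M, also has k-th power e, so that w has monodromy e^2 = 1 and x is a
    closed gap of w.  This happens at the closed gaps of v, where M = 1 or
    M = -1, and at the roots of P = K cos (pi j / k), 0 < j < k, where M has the
    distinct eigenvalues exp (i pi j / k) and exp (- i pi j / k), both with k-th
    power (-1)^j.  There are p simple roots for each j.

    Irreducibility ([least_period_shifted_repeat]).  Suppose that w is invariant
    under a cyclic shift by d, with 0 < d <= kp.  Inside the first half this makes d
    a multiple of p if d <= (k-1)p; where the shift crosses the junction of the two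
    halves, it makes d + 1 one if d >= p.  So d > (k-1)p, and then the junction at
    the end of w makes d - 1 a multiple of p as well.  Hence p = 2 and d is odd, so
    d < kp, and comparing the first letter with the one at d gives v_1 = v_2. *)

Set Implicit Arguments.
Unset Strict Implicit.
Unset Printing Implicit Defensive.
Import Order.TTheory GRing.Theory Num.Theory.

Local Open Scope ring_scope.
Local Open Scope complex_scope.

(** * Bands of a real polynomial with real-rooted levels *)

Lemma prod_XsubC_horner (R : comNzRingType) (s : seq R) (x : R) :
  (\prod_(z <- s) ('X - z%:P)).[x] = \prod_(i < size s) (x - s`_i).
Proof.
rewrite horner_prod (big_nth 0) big_mkord.
by apply: eq_bigr => i _; rewrite hornerXsubC.
Qed.

(** Once a factor X - x is divided out of p, the derivative of p at x is the value
    of the quotient there. *)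
Lemma double_root_count (F : fieldType) (s : seq F) (x : F) :
  let p := \prod_(z <- s) ('X - z%:P) in
  root p x -> root p^`() x -> (1 < count_mem x s)%N.
Proof.
move=> p; rewrite /p root_prod_XsubC => xs.
rewrite (perm_big _ (perm_to_rem xs)) /= big_cons derivM derivXsubC mul1r.
rewrite /root hornerD hornerM hornerXsubC subrr mul0r addr0 -/(root _ x).
rewrite root_prod_XsubC (permP (perm_to_rem xs)) /= eqxx add1n ltnS.
by rewrite -has_count has_pred1.
Qed.

(** Each root to the right of x contributes one sign. *)
Lemma sign_prod_sub (R : realDomainType) (s : seq R) (x : R) (i : nat) :
    (i <= size s)%N ->
    (forall j, (j < i)%N -> s`_j < x) ->
    (forall j, (i <= j < size s)%N -> x < s`_j) ->
  0 < (-1) ^+ (size s - i) * (\prod_(z <- s) ('X - z%:P)).[x].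
Proof.
move=> le_is lo hi; rewrite prod_XsubC_horner.
rewrite -(big_mkord xpredT (fun j => x - s`_j)) (big_cat_nat (leq0n i) le_is) /=.
rewrite mulrCA; apply: mulr_gt0.
  by rewrite big_seq prodr_gt0 // => j; rewrite mem_index_iota subr_gt0 => /andP[_ /lo].
rewrite -prodr_const_nat -big_split /= big_seq prodr_gt0 // => j.
by rewrite mem_index_iota mulN1r opprB subr_gt0 => /hi.
Qed.

Section Bands.
Variables (R : rcfType) (P : {poly R}) (kappa : R) (n : nat) (mu : R -> seq R).
Hypothesis kappa_gt0 : 0 < kappa.
Hypothesis n_gt0 : (0 < n)%N.
Hypothesis size_mu : forall c, `|c| <= kappa -> size (mu c) = n.
Hypothesis sorted_mu : forall c, `|c| <= kappa -> sorted <=%R (mu c).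
Hypothesis mu_fact : forall c, `|c| <= kappa ->
  P - c%:P = \prod_(z <- mu c) ('X - z%:P).
Hypothesis uniq_mu : forall c, `|c| < kappa -> uniq (mu c).

Lemma mem_level c x : `|c| <= kappa -> (x \in mu c) = (P.[x] == c).
Proof.
by move=> hc; rewrite -root_prod_XsubC -mu_fact // /root hornerD hornerN hornerC subr_eq0.
Qed.

Lemma double_level c x : `|c| <= kappa -> P.[x] = c -> P^`().[x] = 0 ->
  (1 < count_mem x (mu c))%N.
Proof.
move=> hc Px P'x; apply: double_root_count; rewrite -mu_fact //.
  by rewrite /root hornerD hornerN hornerC Px subrr.
by rewrite derivB derivC subr0 /root P'x.
Qed.

(** A critical point at a level inside ]-kappa, kappa[ would be a double root of
    P - c, against the simplicity of the roots at such levels. *)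
Lemma critical_value x : P^`().[x] = 0 -> kappa <= `|P.[x]|.
Proof.
move=> P'x; rewrite leNgt; apply/negP => lt.
have := double_level (ltW lt) erefl P'x.
by rewrite count_uniq_mem ?uniq_mu //; case: (_ \in _).
Qed.

Lemma level_sign c x i : `|c| <= kappa -> (i <= n)%N ->
    (forall j, (j < i)%N -> (mu c)`_j < x) ->
    (forall j, (i <= j < n)%N -> x < (mu c)`_j) ->
  0 < (-1) ^+ (n - i) * (P.[x] - c).
Proof.
move=> hc hi lo up.
have := @sign_prod_sub R (mu c) x i; rewrite size_mu // -mu_fact //.
by rewrite hornerD hornerN hornerC; apply.
Qed.

(** For e = true a point to the left of all the bands, for e = false one to their
    right, where P has already left the interval [-kappa, kappa]: all the roots of
    P + kappa and P - kappa are on one side of it. *)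
Lemma outer_point (e : bool) : exists y,
  [/\ kappa <= (-1) ^+ (n * e) * P.[y],
      e -> forall x, x \in mu 0 -> y < x &
      ~~ e -> forall x, x \in mu 0 -> x < y].
Proof.
have hK : `|kappa| <= kappa by rewrite gtr0_norm.
have hNK : `| - kappa| <= kappa by rewrite normrN.
pose S := mu kappa ++ mu (- kappa) ++ mu 0.
pose B := 1 + \sum_(x <- S) `|x|.
have SB x : x \in S -> `|x| < B.
  move=> xS; rewrite /B (big_rem _ xS) /=.
  by rewrite ltr_pwDl // lerDl sumr_ge0.
have mS c j : c \in [:: kappa; - kappa] -> (j < n)%N ->
    - B < (mu c)`_j /\ (mu c)`_j < B.
  move=> hc hj; apply/andP; rewrite -ltr_norml; apply: SB.
  move: hc; rewrite !inE => /orP[] /eqP ->; rewrite !mem_cat mem_nth ?orbT //.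
    by rewrite size_mu.
  by rewrite size_mu.
have m0 x : x \in mu 0 -> - B < x /\ x < B.
  move=> hx; apply/andP; rewrite -ltr_norml; apply: SB.
  by rewrite !mem_cat hx !orbT.
exists (if e then - B else B); split; last 2 first.
- by move=> -> x /m0[].
- by move/negbTE => -> x /m0[].
case: e => /=.
  have h c : c \in [:: kappa; - kappa] -> 0 < (-1) ^+ (n - 0) * (P.[- B] - c).
    move=> hc; apply: level_sign => // [|j /andP[_ hj]]; last by case: (mS c j).
    by move: hc; rewrite !inE => /orP[] /eqP ->.
  have := h kappa; have := h (- kappa); rewrite !inE !eqxx orbT subn0 muln1.
  by move=> /(_ isT) + /(_ isT); rewrite -signr_odd; case: (odd n) => /=; lra.
have := @level_sign kappa B n hK (leqnn _); rewrite subnn expr0 muln0 expr0 !mul1r.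
move=> h; suff: 0 < P.[B] - kappa by lra.
apply: h => [j hj|j]; last by rewrite leqNgt; case: (j < n)%N.
by case: (@mS kappa j); rewrite ?inE ?eqxx.
Qed.

(** The points that separate the bands.  Rolle gives a critical point between two
    consecutive roots of P; by [critical_value] P leaves [-kappa, kappa] there, with
    the sign that it has between these two roots. *)
Lemma nodes_exist : exists eta : nat -> R,
  [/\ forall i, (i < n)%N -> eta i < eta i.+1,
      forall i, (i <= n)%N -> kappa <= (-1) ^+ (n - i) * P.[eta i] &
      forall i, (0 < i < n)%N -> P^`().[eta i] = 0].
Proof.
have h0 : `|0 : R| < kappa by rewrite normr0.
have h0' := ltW h0.
set r := mu 0.
have sr : size r = n by apply: size_mu.
have lt_r i j : (i < j < n)%N -> r`_i < r`_j.
  move=> /andP[ij jn]; have sl : sorted <%R r.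
    by rewrite lt_sorted_uniq_le uniq_mu // sorted_mu.
  by rewrite (lt_sorted_ltn_nth 0 sl) // inE sr // (ltn_trans ij).
have [lo [lo1 lo2 _]] := outer_point true.
have [up [up1 _ up2]] := outer_point false.
have Pr i : (i < n)%N -> P.[r`_i] = 0.
  by move=> hi; apply/eqP; rewrite -mem_level // mem_nth // sr.
have rolle i : {y | (i.+1 < n)%N -> [/\ r`_i < y, y < r`_i.+1 & P^`().[y] = 0]}.
  case: (ltnP i.+1 n) => hi; last by exists 0.
  have lt_ri : r`_i < r`_i.+1 by rewrite lt_r // ltnSn.
  have eq_Pr : P.[r`_i] = P.[r`_i.+1] by rewrite !Pr // ltnW.
  by have [y /itvP y_in y3] := poly_rolle lt_ri eq_Pr; exists y; rewrite !y_in.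
have [xi xiP] : {xi : nat -> R | forall i, (i.+1 < n)%N ->
    [/\ r`_i < xi i, xi i < r`_i.+1 & P^`().[xi i] = 0]}.
  by exists (fun i => sval (rolle i)) => i; apply: (svalP (rolle i)).
pose eta i := if i is j.+1 then if (i < n)%N then xi j else up else lo.
have etaS i : (i.+1 < n)%N ->
   [/\ r`_i < eta i.+1, eta i.+1 < r`_i.+1 & P^`().[eta i.+1] = 0].
  by move=> hi; rewrite /eta hi; apply: xiP.
have eta_lt i : (i < n)%N -> eta i < r`_i.
  case: i => [|i] hi; first by apply: lo2; rewrite // mem_nth // sr.
  by case: (etaS _ hi).
have lt_eta i : (i < n)%N -> r`_i < eta i.+1.
  move=> hi; case: (ltnP i.+1 n) => hi'; first by case: (etaS _ hi').
  by rewrite /= ltnNge hi' /=; apply: up2; rewrite // mem_nth // sr.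
exists eta; split.
- by move=> i hi; apply: lt_trans (eta_lt _ hi) (lt_eta _ hi).
- case=> [_|i]; first by rewrite subn0; move: lo1; rewrite muln1.
  rewrite leq_eqVlt => /orP[/eqP e|hi].
    by rewrite /eta e ltnn subnn -(muln0 n).
  have [y1 y2 y3] := etaS i hi.
  have := critical_value y3.
  have := @level_sign 0 (eta i.+1) i.+1 h0' (ltnW hi).
  rewrite subr0 -/r => h1 h2.
  have {h1} : 0 < (-1) ^+ (n - i.+1) * P.[eta i.+1].
    apply: h1 => [j hj|j /andP[j1 j2]].
      apply: le_lt_trans y1; move: hj; rewrite ltnS leq_eqVlt => /orP[/eqP -> //|hj].
      by rewrite ltW // lt_r // hj ltnW.
    apply: (lt_le_trans y2); move: j1; rewrite leq_eqVlt => /orP[/eqP <- //|j1].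
    by rewrite ltW // lt_r // j1.
  by move=> /gtr0_norm <-; rewrite normrM normr_sign mul1r.
- by case=> // i hi; case: (etaS i hi).
Qed.

Section Nodes.
Variable eta : nat -> R.
Hypothesis eta_lt : forall i, (i < n)%N -> eta i < eta i.+1.
Hypothesis eta_val : forall i, (i <= n)%N -> kappa <= (-1) ^+ (n - i) * P.[eta i].
Hypothesis eta_crit : forall i, (0 < i < n)%N -> P^`().[eta i] = 0.

Lemma eta_mono i j : (i < j <= n)%N -> eta i < eta j.
Proof.
elim: j => // j IH /andP[]; rewrite ltnS leq_eqVlt => /orP[/eqP -> //|ij] jn.
  exact: eta_lt.
by apply: lt_trans (eta_lt jn); apply: IH; rewrite ij ltnW.
Qed.

Lemma eta_mono_le i j : (i <= j <= n)%N -> eta i <= eta j.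
Proof.
case/andP; rewrite leq_eqVlt => /orP[/eqP -> //|ij jn].
by apply/ltW/eta_mono; rewrite ij.
Qed.

(** Roots of P - c picked one in each of the intervals [eta i, eta i.+1] are all
    the roots, with multiplicity.  Two of them can only coincide at a common
    endpoint, which is critical, so that the root is double; and three of them never
    coincide.  This covers the extreme levels c = kappa and c = - kappa, where gaps
    may close. *)
Lemma bracketed_roots c ys : `|c| <= kappa -> size ys = n ->
    (forall i, (i < n)%N -> [/\ eta i <= ys`_i, ys`_i <= eta i.+1 & P.[ys`_i] = c]) ->
  ys = mu c.
Proof.
move=> hc sy H.
have sorted_ys : sorted <=%R ys.
  apply/(sortedP 0) => i; rewrite sy => hi.
  by case: (H _ hi) => h _ _; case: (H _ (ltnW hi)) => _ h' _; apply: le_trans h' h.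
have key x : (count_mem x ys <= count_mem x (mu c))%N.
  have -> : count_mem x ys = #|[set i : 'I_n | ys`_i == x]|.
    rewrite -sum1_count (big_nth 0) sy big_mkord.
    by rewrite -sum1_card; apply: eq_bigl => i; rewrite inE.
  set S := [set i : 'I_n | _].
  have memS (i : 'I_n) : i \in S -> [/\ eta i <= x, x <= eta i.+1 & P.[x] = c].
    by rewrite inE => /eqP <-; apply: H.
  case: (ltnP 1 #|S|) => [/card_gt1P [i [j [iS jS ij]]] | le1].
    wlog lt_ij : i j iS jS ij / (i < j)%N.
      move=> W; move: (ij); rewrite neq_ltn => /orP[] h.
        exact: (W i j).
      by apply: (W j i); rewrite // eq_sym.
    (* Two indices with the same root are consecutive, and the root is a node. *)
    have step (a b : 'I_n) : a \in S -> b \in S -> (a < b)%N ->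
        b = a.+1 :> nat /\ x = eta b.
      move=> aS bS ab; have [_ xa _] := memS _ aS; have [bx _ _] := memS _ bS.
      have ab' : eta a.+1 <= eta b by apply: eta_mono_le; rewrite ab ltnW.
      split; last by apply/le_anti; rewrite bx (le_trans xa).
      apply/eqP; rewrite eqn_leq ab andbT leqNgt; apply/negP => h.
      suff : eta a.+1 < eta a.+1 by rewrite ltxx.
      apply: lt_le_trans (le_trans bx xa); apply: eta_mono.
      by rewrite h ltnW.
    have [ej xj] := step _ _ iS jS lt_ij.
    have [_ _ Px] := memS _ iS.
    have S2 : S \subset [set i; j].
      apply/fintype.subsetP => l lS; rewrite !inE.
      case: (ltngtP l i) => [li|il|/val_inj ->]; last by rewrite eqxx.
        have [e _] := step _ _ lS iS li.
        by have [] := step _ _ lS jS (ltn_trans li lt_ij); lia.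
      have [e _] := step _ _ iS lS il.
      by apply/orP; right; apply/eqP/val_inj; rewrite /= e ej.
    apply: leq_trans (subset_leq_card S2) _; rewrite cards2 ij.
    apply: double_level => //; rewrite xj; apply: eta_crit.
    by rewrite ej /= -ej.
  case: (posnP #|S|) => [-> //|]; rewrite card_gt0 => /set0Pn [i iS].
  apply: leq_trans le1 _; rewrite -has_count has_pred1 mem_level //.
  by have [_ _ ->] := memS _ iS.
have [s sub pe] := (count_subseqP ys (mu c)).1 key.
apply: (sorted_eq le_trans le_anti sorted_ys (sorted_mu hc)).
suff <- : s = mu c by [].
apply/eqP; rewrite -(size_subseq_leqif sub).2 size_mu //.
by rewrite -(perm_size pe) sy.
Qed.

(** The sign (-1) ^+ e treats ascending and descending bands together. *)
Lemma level_between c a b (e : bool) : a <= b ->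
    (-1) ^+ e * P.[a] <= (-1) ^+ e * c <= (-1) ^+ e * P.[b] ->
  exists2 y, a <= y <= b & P.[y] = c.
Proof.
move=> ab h; have [|y y_in /eqP] := @polyrcf.poly_ivt _ (P - c%:P) a b ab.
  case/andP: h; rewrite !hornerE; case: e => /= h1 h2; nra.
by rewrite !hornerE => /subr0_eq Py; exists y; rewrite // (itvP y_in).
Qed.

(** The direction, 1 or -1, in which P crosses the j-th band. *)
Definition band_sign j : R := (-1) ^+ (n - j.+1).

Lemma node_left c i : `|c| <= kappa -> (i < n)%N ->
  band_sign i * P.[eta i] <= band_sign i * c.
Proof.
move=> hc hi; have := eta_val (ltnW hi); rewrite /band_sign.
have -> : (n - i = (n - i.+1).+1)%N by lia.
rewrite exprS -signr_odd; move: hc; rewrite ler_norml => /andP[].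
by case: (odd _) => /=; lra.
Qed.

Lemma node_right c i : `|c| <= kappa -> (i < n)%N ->
  band_sign i * c <= band_sign i * P.[eta i.+1].
Proof.
move=> hc hi; have := eta_val hi; rewrite /band_sign.
rewrite -signr_odd; move: hc; rewrite ler_norml => /andP[].
by case: (odd _) => /=; lra.
Qed.

Lemma mu_bracket c i : `|c| <= kappa -> (i < n)%N ->
  [/\ eta i <= (mu c)`_i, (mu c)`_i <= eta i.+1 & P.[(mu c)`_i] = c].
Proof.
move=> hc.
have ex j : {y | (j < n)%N -> [/\ eta j <= y, y <= eta j.+1 & P.[y] = c]}.
  case: (ltnP j n) => hj; last by exists 0.
  have [|y y_in /eqP] := @polyrcf.poly_ivt _ (P - c%:P) _ _ (ltW (eta_lt hj)).
    have := node_left hc hj; have := node_right hc hj.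
    by rewrite /band_sign -signr_odd !hornerE; case: (odd _) => /= h1 h2; nra.
  by rewrite !hornerE => /subr0_eq Py; exists y; rewrite ?(itvP y_in).
pose ys := mkseq (fun j => sval (ex j)) n.
have ysP j : (j < n)%N -> [/\ eta j <= ys`_j, ys`_j <= eta j.+1 & P.[ys`_j] = c].
  by move=> hj; rewrite nth_mkseq //; apply: (svalP (ex j)).
have <- : ys = mu c by apply: bracketed_roots; rewrite ?size_mkseq.
exact: ysP.
Qed.

(** Substituting y for the i-th root leaves a family that [bracketed_roots]
    applies to. *)
Lemma level_unique c i y : `|c| <= kappa -> (i < n)%N ->
  eta i <= y <= eta i.+1 -> P.[y] = c -> y = (mu c)`_i.
Proof.
move=> hc hi /andP[y1 y2] Py.
suff <- : set_nth 0 (mu c) i y = mu c by rewrite nth_set_nth /= eqxx.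
apply: bracketed_roots => // [|j hj].
  by rewrite size_set_nth size_mu //; apply/maxn_idPr.
by rewrite nth_set_nth /=; case: eqP => [->|_]; last exact: mu_bracket.
Qed.

(** Between its left node and its root at the upper edge, P passes through the
    level c; as there is one root per band, the root at c lies before that edge. *)
Lemma band_edges_node c i : `|c| <= kappa -> (i < n)%N ->
  (mu (- band_sign i * kappa))`_i <= (mu c)`_i <= (mu (band_sign i * kappa))`_i.
Proof.
move=> hc hi.
have bs : band_sign i = 1 \/ band_sign i = -1.
  by rewrite /band_sign -signr_odd; case: (odd _); [right|left].
have b2 : band_sign i * band_sign i = 1 by case: bs => ->; rewrite ?mulrNN mulr1.
have hp : `|band_sign i * kappa| <= kappa.
  by case: bs => ->; rewrite ?mulN1r ?mul1r ?normrN gtr0_norm.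
have hm : `|- band_sign i * kappa| <= kappa by rewrite mulNr normrN.
have [p1 p2 p3] := mu_bracket hp hi; have [m1 m2 m3] := mu_bracket hm hi.
have bc : - kappa <= band_sign i * c <= kappa.
  by rewrite -ler_norml; case: bs => ->; rewrite ?mulN1r ?mul1r ?normrN.
case/andP: bc => bc1 bc2.
have eb : exists e : bool, band_sign i = (-1) ^+ e.
  by exists (odd (n - i.+1)); rewrite signr_odd.
case: eb => e eb; apply/andP; split.
- have [|y /andP[y1 y2] Py] := @level_between c _ _ e m2.
    by rewrite -eb node_right // m3 mulrA mulrN b2 mulN1r bc1.
  rewrite -(level_unique hc hi _ Py) //.
  by rewrite y2 (le_trans m1 y1).
- have [|y /andP[y1 y2] Py] := @level_between c _ _ e p1.
    by rewrite -eb node_left //= p3 mulrA b2 mul1r bc2.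
  rewrite -(level_unique hc hi _ Py) //.
  by rewrite y1 (le_trans y2 p2).
Qed.

End Nodes.

(** P crosses [-kappa, kappa] once along each band, so that the ends of the band
    are its roots at the two extreme levels. *)
Lemma band_edges c i : `|c| <= kappa -> (i < n)%N ->
  (mu (- band_sign i * kappa))`_i <= (mu c)`_i <= (mu (band_sign i * kappa))`_i.
Proof. by have [eta [h1 h2 h3]] := nodes_exist; apply: band_edges_node h1 h2 h3 c i. Qed.

End Bands.

(** * The characteristic polynomial of the Floquet matrices *)

Section Corners.
Variables (S : comNzRingType) (n : nat).
Implicit Types Q : 'M[S]_n.+2.

Definition corners Q (s t : S) : 'M[S]_n.+2 :=
  Q + s *: delta_mx ord_max ord0 + t *: delta_mx ord0 ord_max.

Definition last_row_e0 Q : 'M[S]_n.+2 :=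
  \matrix_(i, j) (if i == ord_max then (j == ord0)%:R else Q i j).

Lemma det_last_corner Q s t :
  \det (corners Q s t) = \det (corners Q 0 t) + s * \det (last_row_e0 (corners Q 0 t)).
Proof.
rewrite -[X in X + _]mul1r.
apply: (determinant_multilinear (i0 := ord_max)).
- by apply/rowP => j; rewrite !mxE eqxx /=; ring.
- apply/matrixP => i j; rewrite !mxE eq_sym (negbTE (neq_lift _ _)) /=; ring.
- by apply/matrixP => i j; rewrite !mxE eq_sym (negbTE (neq_lift _ _)) /=; ring.
Qed.

Definition swapped_rows Q : 'M[S]_n.+2 :=
  \matrix_(i, j) (if i == ord0 then (j == ord_max)%:R else last_row_e0 Q i j).

Lemma det_first_corner Q t :
  \det (last_row_e0 (corners Q 0 t)) = \det (last_row_e0 Q) + t * \det (swapped_rows Q).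
Proof.
rewrite -[X in X + _]mul1r.
apply: (determinant_multilinear (i0 := ord0)).
- by apply/rowP => j; rewrite !mxE eqxx /=; ring.
- apply/matrixP => i j; rewrite !mxE (_ : lift ord0 i == ord0 = false) //=.
  by case: (_ == ord_max) => //; ring.
- apply/matrixP => i j; rewrite !mxE (_ : lift ord0 i == ord0 = false) //=.
  by case: (_ == ord_max) => //; ring.
Qed.

Lemma tr_corners Q s t : Q^T = Q -> (corners Q s t)^T = corners Q t s.
Proof.
by move=> QT; rewrite /corners !linearD /= !linearZ /= !trmx_delta QT addrAC.
Qed.

(** The determinant is affine in each of the two corner entries.  By the symmetry
    of Q the two linear coefficients are equal, so that they only contribute through
    s + t; this is what makes the Floquet determinant depend on theta by its cosine. *)
Lemma det_corners Q s t : Q^T = Q ->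
  \det (corners Q s t) =
    \det Q + (s + t) * \det (last_row_e0 Q) + s * t * \det (swapped_rows Q).
Proof.
move=> QT; have c0 : corners Q 0 0 = Q by rewrite /corners !scale0r !addr0.
rewrite det_last_corner det_first_corner -(det_tr (corners Q 0 t)) tr_corners //.
by rewrite det_last_corner c0; ring.
Qed.

(** Expanding along the last row leaves the lower triangular minor whose diagonal
    is the first superdiagonal of Q. *)
Lemma det_last_row_e0 Q :
    (forall i j : 'I_n.+2, (i.+1 < j)%N -> Q i j = 0) ->
  \det (last_row_e0 Q) =
    \prod_(i < n.+1) - Q (widen_ord (leqnSn _) i) (lift ord0 i).
Proof.
move=> Qtri.
have liftE (i : 'I_n.+1) : lift ord_max i = widen_ord (leqnSn _) i.
  exact/val_inj/lift_max.
rewrite (expand_det_row _ ord_max) (bigD1 ord0) //= big1 ?addr0; last first.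
  by move=> j j0; rewrite !mxE eqxx (negbTE j0) mul0r.
rewrite !mxE !eqxx mul1r /cofactor /= addn0 det_trig.
  rewrite -[X in (-1) ^+ X](card_ord n.+1) -prodr_const -big_split /=.
  apply: eq_bigr => i _; rewrite !mxE eq_sym (negbTE (neq_lift _ _)) mulN1r.
  by rewrite liftE.
apply/is_trig_mxP => i j ij; rewrite !mxE eq_sym (negbTE (neq_lift _ _)).
by rewrite liftE; apply: Qtri; rewrite /= /bump leq0n add1n !ltnS.
Qed.
End Corners.

Section FloquetPoly.
Variable R : realType.
Notation C := (R[i]).

(** Taking the corner terms apart is also correct for p = 2, where they are added
    to the off-diagonal entries. *)
Lemma floquet_corners n (a v : 'rV[R]_n.+2) :
  exists2 J0 : 'M[C]_n.+2,
    [/\ J0^T = J0, (forall i j : 'I_n.+2, (i.+1 < j)%N -> J0 i j = 0) &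
       forall i : 'I_n.+1, J0 (widen_ord (leqnSn _) i) (lift ord0 i) = (a 0 (widen_ord (leqnSn _) i))%:C] &
    forall theta, floquet a v theta =
      corners J0 (expi theta * (a 0 ord_max)%:C) (expi (- theta) * (a 0 ord_max)%:C).
Proof.
exists (\matrix_(i < n.+2, j < n.+2)
    ((v 0 i)%:C *+ (i == j)
     + (a 0 i)%:C *+ (j == i.+1 :> nat)
     + (a 0 j)%:C *+ (i == j.+1 :> nat))); first split.
- apply/matrixP => i j; rewrite !mxE eq_sym.
  by case: eqP => [->|_]; rewrite // addrAC.
- move=> i j ij; rewrite !mxE.
  have -> : (i == j) = false by apply/eqP => e; move: ij; rewrite e; lia.
  have -> : (j == i.+1 :> nat) = false by lia.
  have -> : (i == j.+1 :> nat) = false by lia.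
  by rewrite !mulr0n !addr0.
- move=> i; rewrite !mxE.
  have -> : (widen_ord (leqnSn n.+1) i == lift ord0 i) = false.
    by apply/eqP => /(congr1 val) /=; rewrite /bump /=; lia.
  rewrite /= /bump leq0n add1n eqxx.
  have -> : (i == i.+2 :> nat) = false by lia.
  by rewrite !mulr0n addr0 add0r.
move=> theta; apply/matrixP => i j; rewrite !mxE.
have e0 (l : 'I_n.+2) : (l == 0%N :> nat) = (l == ord0) by [].
have em (l : 'I_n.+2) : (l == n.+1 :> nat) = (l == ord_max) by [].
rewrite /= !e0 !em addrAC.
congr (_ + _ + _).
  by rewrite mulr_natr; case: (j =P ord_max) => [->|_]; rewrite ?andbF ?mulr0n.
by rewrite mulr_natr; case: (i =P ord_max) => [->|_]; rewrite ?andbF ?mulr0n.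
Qed.

Lemma floquet_char_poly_const p (a v : 'rV[R]_p) : (1 < p)%N ->
  exists P0 : {poly C}, forall theta,
    char_poly (floquet a v theta) =
      P0 - ((2 * (\prod_i a 0 i) * cos (2 * pi * theta))%:C)%:P.
Proof.
case: p a v => [|[|n]] a v // _.
have [J0 [J0T J0tri J0off] J0E] := floquet_corners a v.
set Q := char_poly_mx J0.
have QT : Q^T = Q by rewrite /Q /char_poly_mx linearB /= tr_scalar_mx map_trmx J0T.
pose am : {poly C} := (a 0 ord_max)%:C%:P.
exists (\det Q + am * am * \det (swapped_rows Q)) => theta.
have -> : char_poly (floquet a v theta) =
    \det (corners Q (- ((expi theta)%:P * am)) (- ((expi (- theta))%:P * am))).
  congr (\det _); rewrite J0E /corners /Q /char_poly_mx.
  rewrite !map_mxD !map_mxZ !map_delta_mx !scaleNr /am.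
  by rewrite !opprD !addrA -!polyCM.
rewrite det_corners // det_last_row_e0; last first.
  move=> i j ij; rewrite !mxE J0tri // subr0.
  by have -> : (i == j) = false by apply/eqP => e; move: ij; rewrite e; lia.
have -> : \prod_(i < n.+1) - Q (widen_ord (leqnSn n.+1) i) (lift ord0 i) =
    ((\prod_(i < n.+1) a 0 (widen_ord (leqnSn n.+1) i))%:C)%:P.
  rewrite !rmorph_prod; apply: eq_bigr => i _; rewrite !mxE J0off.
  have -> : (widen_ord (leqnSn n.+1) i == lift ord0 i) = false.
    by apply/eqP => /(congr1 val) /=; rewrite /bump /=; lia.
  by rewrite mulr0n sub0r opprK.
have e1 : expi theta * expi (- theta) = 1 :> C.
  rewrite /expi mulrN cosN sinN; simpc; rewrite -!expr2 cos2Dsin2.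
  by congr (_ +i* _); ring.
have e2 : expi theta + expi (- theta) = (2 * cos (2 * pi * theta))%:C :> C.
  rewrite /expi mulrN cosN sinN; simpc; congr (_ +i* _); ring.
rewrite [in RHS]big_ord_recr /=.
have -> : - ((expi theta)%:P * am) - (expi (- theta))%:P * am = 
   - (((2 * cos (2 * pi * theta))%:C)%:P * am).
  by rewrite -e2 polyCD; ring.
have -> : - ((expi theta)%:P * am) * - ((expi (- theta))%:P * am) = am * am.
  transitivity ((expi theta * expi (- theta))%:P * am * am).
    by rewrite polyCM; ring.
  by rewrite e1 mul1r.
rewrite /am !rmorphM /=; ring.
Qed.

Lemma floquet0_real p (a v : 'rV[R]_p) :
  map_mx (real_complex R) (map_mx (@complex.Re R) (floquet a v 0)) = floquet a v 0.
Proof.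
apply/matrixP => i j; rewrite !mxE /expi oppr0 mulr0 cos0 sin0.
rewrite !mul1r -!(rmorphMn (real_complex R)) -!(rmorphD (real_complex R)) /=.
by [].
Qed.

(** At theta = 0 the matrix is real, hence so is the polynomial that does not
    depend on theta. *)
Lemma floquet_char_poly p (a v : 'rV[R]_p) : (1 < p)%N ->
  exists P : {poly R}, forall theta,
    char_poly (floquet a v theta) =
      map_poly (real_complex R) (P - (2 * (\prod_i a 0 i) * cos (2 * pi * theta))%:P).
Proof.
move=> hp; have [P0 P0E] := floquet_char_poly_const a v hp.
set J := map_mx (@complex.Re R) (floquet a v 0).
exists (char_poly J + (2 * (\prod_i a 0 i))%:P) => theta.
rewrite rmorphB rmorphD /= !map_polyC /= map_char_poly floquet0_real !P0E.
by rewrite mulr0 cos0 mulr1 subrK.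
Qed.
End FloquetPoly.

(** * Eigenvalues of Hermitian matrices and their multiplicities *)

(** The row space is the direct sum of the lines spanned by the basis vectors at
    the nonzero entries. *)
Lemma rank_diag_mx (F : fieldType) p (d : 'rV[F]_p) :
  \rank (diag_mx d) = #|[pred i | d 0 i != 0]|.
Proof.
have -> : \rank (diag_mx d) =
    \rank (\sum_(i | d 0 i != 0) <<delta_mx 0 i : 'rV[F]_p>>)%MS.
  apply/eqmx_rank/andP; split.
    apply/row_subP => i; rewrite row_diag_mx.
    case: (eqVneq (d 0 i) 0) => [->|di]; first by rewrite scale0r sub0mx.
    by rewrite scalemx_sub // (sumsmx_sup i) // genmxE.
  apply/sumsmx_subP => i di; rewrite genmxE.
  have -> : delta_mx 0 i = (d 0 i)^-1 *: row i (diag_mx d).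
    by rewrite row_diag_mx scalerA mulVf // scale1r.
  by rewrite scalemx_sub // row_sub.
rewrite (mxdirectP (mxdirect_delta _ (f := id) (in2W (fun _ _ => id)))) /= -sum1_card.
by apply: eq_bigr => i _; rewrite mxrank_gen mxrank_delta.
Qed.

Lemma char_poly_similar (F : fieldType) p (U B : 'M[F]_p) : U \in unitmx ->
  char_poly (invmx U *m B *m U) = char_poly B.
Proof.
move=> Uu; have UV : map_mx polyC (invmx U) *m map_mx polyC U = 1%:M.
  by rewrite -map_mxM mulVmx // map_mx1.
have -> : char_poly (invmx U *m B *m U) =
    \det (map_mx polyC (invmx U) *m char_poly_mx B *m map_mx polyC U).
  congr (\det _); rewrite /char_poly_mx mulmxBr mulmxBl !map_mxM.
  by rewrite scalar_mxC -[_%:M *m _ *m _]mulmxA UV mulmx1.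
by rewrite !det_mulmx mulrAC -det_mulmx UV det1 mul1r.
Qed.

Section Spectrum.
Variable R : realType.
Notation C := (R[i]).

Lemma floquet_hermitian p (a v : 'rV[R]_p) theta :
  floquet a v theta \is hermsymmx.
Proof.
apply/is_hermitianmxP; rewrite expr0 scale1r.
have expi_conj t : Num.conj (expi t) = expi (- t) :> C.
  by rewrite /expi mulrN cosN sinN.
have cR x : Num.conj (x%:C) = x%:C :> C by apply: conjc_real.
apply/matrixP => i j; rewrite !mxE !rmorphD /= !rmorphMn /= !rmorphM /=.
rewrite !(cR, expi_conj) opprK eq_sym.
rewrite (andbC (j == 0%N :> nat)) (andbC (j == p.-1 :> nat)) !mulrb.
by case: eqP => [->|_]; ring.
Qed.

(** By the spectral theorem the matrix is unitarily similar to a real diagonal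
    one, for which algebraic and geometric multiplicities are both read off the
    diagonal. *)
Lemma hermitian_eigenvals p (A : 'M[C]_p) : A \is hermsymmx ->
  [/\ size (eigenvals A) = p,
      char_poly A = map_poly (real_complex R) (\prod_(z <- eigenvals A) ('X - z%:P)) &
      forall x, count_mem x (eigenvals A) = \rank (eigenspace A x%:C)].
Proof.
move=> Ah; have /hermitian_normalmx/orthomx_spectralP Asp := Ah.
have /mxOverP dreal := hermitian_spectral_diag_real Ah.
set U := spectralmx A in Asp; set d := spectral_diag A in Asp dreal.
have Uu : U \in unitmx by apply: spectral_unit.
pose s := [seq complex.Re (d 0 i) | i <- enum 'I_p].
have dE i : (complex.Re (d 0 i))%:C = d 0 i by apply: RRe_real.
have cpA : char_poly A = \prod_(i < p) ('X - (d 0 i)%:P).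
  rewrite {1}Asp char_poly_similar // char_poly_trig ?diag_mx_is_trig //.
  by apply: eq_bigr => i _; rewrite mxE eqxx.
have sp : perm_eq (spectrum A) [seq d 0 i | i <- enum 'I_p].
  apply: prod_XsubC_eq; rewrite big_map big_enum -cpA /spectrum.
  case: closed_field_poly_normal => r /= e; rewrite [RHS]e.
  by rewrite (monicP (char_poly_monic A)) scale1r.
have es : perm_eq (eigenvals A) s.
  by rewrite /eigenvals perm_sort (perm_trans (perm_map _ sp)) // -map_comp.
split.
- by rewrite (perm_size es) size_map size_enum_ord.
- rewrite cpA (perm_big _ es) /= big_map big_enum rmorph_prod.
  by apply: eq_bigr => i _; rewrite rmorphB /= map_polyX map_polyC /= dE.
move=> x; rewrite (permP es) count_map.
have -> : eigenspace A x%:C = kermx (A - x%:C%:M) by [].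
have -> : A - x%:C%:M = invmx U *m diag_mx (d - const_mx x%:C) *m U.
  rewrite linearB /= mulmxBr mulmxBl -Asp diag_const_mx.
  by rewrite scalar_mxC -[_%:M *m _ *m _]mulmxA mulVmx // mulmx1.
rewrite mxrank_ker mxrankMfree ?row_free_unit //.
rewrite (eqmxMfull _ _) ?row_full_unit ?unitmx_inv // rank_diag_mx.
rewrite -[X in (X - _)%N](card_ord p).
rewrite -(cardC [pred i | (d - const_mx x%:C) 0 i != 0]) addKn.
rewrite -size_filter cardE /enum_mem -filter_predI; congr (size _); apply: eq_filter => i; rewrite !inE !mxE /=.
rewrite andbT negbK subr_eq0 -[X in _ = (X == _)]dE.
by apply/esym/inj_eq => y z [].
Qed.

End Spectrum.

(** * Transfer matrices and monodromy *)

Section Transfer.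
Variable F : fieldType.
Implicit Types (x : F) (alpha nu : nat -> F).

(** For the state (b, y) = (a_(n-1) u_(n-1), u_n), a row vector, the equation
    a_(n-1) u_(n-1) + v_n u_n + a_n u_(n+1) = x u_n gives the next state
    (a_n u_n, u_(n+1)).  With this choice of the first coordinate the matrix involves
    one site only and has determinant 1. *)
Definition transfer x (a v : F) : 'M[F]_2 :=
  \matrix_(i < 2, j < 2)
    if i == 0 then (if j == 0 then 0 else - a^-1)
    else (if j == 0 then a else (x - v) / a).

Definition state (b y : F) : 'rV[F]_2 := \row_(j < 2) if j == 0 then b else y.

Lemma state_transfer x a v b y :
  state b y *m transfer x a v = state (a * y) (((x - v) * y - b) / a).
Proof.
apply/rowP => j; rewrite !mxE big_ord_recl big_ord1 !mxE /=.
by case: eqP => _; ring.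
Qed.

Lemma state_eta (s : 'rV[F]_2) : s = state (s 0 0) (s 0 1).
Proof.
apply/rowP => j; rewrite mxE; case: eqP => [-> //|/eqP].
by case: j => [[|[|[]]]] // h _; congr (s _ _); apply: val_inj.
Qed.

Lemma scale_state c b y : c *: state b y = state (c * b) (c * y).
Proof. by apply/rowP => j; rewrite !mxE; case: ifP. Qed.

Lemma det_transfer x a v : a != 0 -> \det (transfer x a v) = 1.
Proof.
move=> a0; rewrite (expand_det_row _ 0) big_ord_recl big_ord1 !mxE /= mul0r add0r.
by rewrite /cofactor det_mx11 !mxE /= expr1 mulN1r mulrNN mulVf.
Qed.

Definition monodromy x alpha nu (m n : nat) : 'M[F]_2 :=
  \prod_(m <= i < n) transfer x (alpha i) (nu i).

Lemma monodromy_cat x alpha nu l m n : (l <= m)%N -> (m <= n)%N ->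
  monodromy x alpha nu l n = monodromy x alpha nu l m * monodromy x alpha nu m n.
Proof. by move=> lm mn; rewrite /monodromy (big_cat_nat lm mn). Qed.

Lemma monodromy1 x alpha nu m :
  monodromy x alpha nu m m.+1 = transfer x (alpha m) (nu m).
Proof. by rewrite /monodromy big_nat1. Qed.

Lemma det_monodromy x alpha nu m n : (forall i, alpha i != 0) ->
  \det (monodromy x alpha nu m n) = 1.
Proof.
move=> a0; rewrite /monodromy (big_morph _ (@det_mulmx _ 2) (@det1 _ 2)).
by rewrite big1 // => i _; rewrite det_transfer.
Qed.

Lemma eq_monodromy x alpha nu alpha' nu' m n d :
    (forall i, (m <= i < n)%N -> alpha' (i + d)%N = alpha i) ->
    (forall i, (m <= i < n)%N -> nu' (i + d)%N = nu i) ->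
  monodromy x alpha' nu' (m + d) (n + d) = monodromy x alpha nu m n.
Proof.
move=> ea ev; rewrite /monodromy big_addn addnK.
by apply: eq_big_nat => i hi; rewrite ea ?ev.
Qed.

Lemma monodromy_periods x alpha nu p k :
    (forall i, alpha (i + p)%N = alpha i) -> (forall i, nu (i + p)%N = nu i) ->
  monodromy x alpha nu 0 (k * p) = monodromy x alpha nu 0 p ^+ k.
Proof.
move=> pa pv; elim: k => [|k IH].
  by rewrite /monodromy mul0n big_nil.
rewrite mulSn [(p + _)%N]addnC (@monodromy_cat _ _ _ _ (k * p)%N) ?leq_addr // IH exprSr.
have per (f : nat -> F) i : (forall i, f (i + p)%N = f i) -> f (i + k * p)%N = f i.
  move=> pf; elim: (k) => [|j IHj]; first by rewrite addn0.
  by rewrite mulSn addnCA addnC pf.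
congr (_ * _); rewrite -{1}[(k * p)%N]add0n [(k * p + p)%N]addnC.
by apply: eq_monodromy => i _; apply: per.
Qed.

End Transfer.

Section PeriodicJacobi.
Variables (F : fieldType) (q : nat) (alpha nu : nat -> F) (z z' : F).
Hypothesis alpha_neq0 : forall i, alpha i != 0.
Hypothesis zz' : z * z' = 1.
Local Notation p := q.+1.

Definition jacobi : 'M[F]_p :=
  \matrix_(i < p, j < p)
    (nu i *+ (i == j) + alpha i *+ (j == i.+1 :> nat) + alpha j *+ (i == j.+1 :> nat)
     + z' * alpha j *+ ((i == 0%N :> nat) && (j == p.-1 :> nat))
     + z * alpha i *+ ((i == p.-1 :> nat) && (j == 0%N :> nat))).

(** The term a_(n-1) u_(n-1) of the difference equation; at the first site it is
    the corner entry of the matrix. *)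
Definition left_flow (u : nat -> F) n :=
  if n is m.+1 then alpha m * u m else z * alpha q * u q.

Definition right_val (u : nat -> F) n := if (n < q)%N then u n.+1 else z' * u 0%N.

(** A row eigenvector is a solution of the difference equation that is multiplied
    by z' over one period. *)
Lemma row_mul_jacobi (u : nat -> F) (n : 'I_p) :
  ((\row_(i < p) u i) *m jacobi) 0 n =
    nu n * u n + left_flow u n + alpha n * right_val u n.
Proof.
have pick (f : 'I_p -> F) (k : 'I_p) (b : 'I_p -> bool) : (forall i, b i = (i == k)) ->
    \sum_i f i *+ b i = f k.
  by move=> H; rewrite (bigD1 k) //= H eqxx big1 ?addr0 // => i; rewrite H => /negbTE ->.
have none (f : 'I_p -> F) (b : 'I_p -> bool) : (forall i, b i = false) ->
    \sum_i f i *+ b i = 0.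
  by move=> H; rewrite big1 // => i _; rewrite H.
rewrite mxE.
under eq_bigr do rewrite !mxE !mulrDr !mulrnAr.
rewrite !big_split /= (pick _ n); last by [].
have <- : \sum_(i < p) u i * alpha i *+ (n == i.+1 :> nat) +
    \sum_(i < p) u i * (z * alpha i) *+ ((i == q :> nat) && (n == 0%N :> nat)) = left_flow u n.
  case: n => [[|n] hn]; rewrite [left_flow _ _]/=.
    by rewrite [X in X + _]none // add0r (pick _ ord_max) => [|i]; rewrite ?andbT //=; ring.
  rewrite [X in _ + X]none ?addr0 => [|i]; last by rewrite andbF.
  rewrite (pick _ (Ordinal (ltnW hn))) => [|i]; last by rewrite eqSS eq_sym.
  exact: mulrC.
have <- : \sum_(i < p) u i * alpha n *+ (i == n.+1 :> nat) +
    \sum_(i < p) u i * (z' * alpha n) *+ ((i == 0%N :> nat) && (n == q :> nat)) = alpha n * right_val u n.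
  rewrite /right_val; case: ltnP => hn.
    rewrite [X in _ + X]none ?addr0 => [|i]; last by rewrite (ltn_eqF hn) andbF.
    by rewrite (pick _ (Ordinal (hn : n.+1 < p)%N)) // mulrC.
  have -> : n = q :> nat by apply/eqP; rewrite eqn_leq hn -ltnS ltn_ord.
  rewrite none => [|i]; last by rewrite ltn_eqF.
  by rewrite add0r (pick _ ord0) => [|i]; rewrite ?eqxx ?andbT //=; ring.
ring.
Qed.

Definition flow_state u n :=
  state (left_flow u n) (if (n < p)%N then u n else z' * u 0%N).

Definition is_eigen x (u : nat -> F) := forall n, (n < p)%N ->
  (x - nu n) * u n = left_flow u n + alpha n * right_val u n.

Lemma is_eigenP x (u : nat -> F) :
  is_eigen x u <-> (\row_(i < p) u i) *m jacobi = x *: (\row_(i < p) u i).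
Proof.
split=> [H|H n hn].
  apply/rowP => n; rewrite row_mul_jacobi !mxE -addrA -H //; ring.
have /rowP/(_ (Ordinal hn)) := H; rewrite row_mul_jacobi !mxE /= => e.
by rewrite mulrBl -e; ring.
Qed.

Lemma flow_stateE x u n : is_eigen x u -> (n <= p)%N ->
  flow_state u n = flow_state u 0 *m monodromy x alpha nu 0 n.
Proof.
move=> H; elim: n => [|n IH] hn; first by rewrite /monodromy big_geq // mulmx1.
rewrite (@monodromy_cat _ _ _ _ _ n) // monodromy1 -[_ * _]/(_ *m _) mulmxA -IH 1?ltnW //.
rewrite /flow_state state_transfer hn; congr state.
by rewrite H // addrC addKr mulrAC divff // mul1r.
Qed.

Lemma flow_state_period u : flow_state u p = z' *: flow_state u 0.
Proof.
rewrite /flow_state ltnn /= scale_state; congr state.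
by rewrite !mulrA [z' * z]mulrC zz' mul1r.
Qed.

Lemma flow_state_inj x u : is_eigen x u -> flow_state u 0 = 0 ->
  forall n, (n < p)%N -> u n = 0.
Proof.
move=> H u0 n hn; have := flow_stateE H (ltnW hn).
rewrite u0 mul0mx /flow_state hn => /rowP/(_ 1).
by rewrite !mxE.
Qed.

(** Converse of [flow_stateE]: an orbit of the transfer matrices that is
    multiplied by z' over one period is an eigenvector. *)
Lemma is_eigen_orbit x (b y : nat -> F) :
    (forall n, state (b n) (y n) = state (b 0%N) (y 0%N) *m monodromy x alpha nu 0 n) ->
    state (b p) (y p) = z' *: state (b 0%N) (y 0%N) ->
  is_eigen x y /\ flow_state y 0 = state (b 0%N) (y 0%N).
Proof.
move=> H Hp.
have step m : state (b m.+1) (y m.+1) = state (alpha m * y m) (((x - nu m) * y m - b m) / alpha m).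
  rewrite H (@monodromy_cat _ _ _ _ _ m) // monodromy1 -[_ * _]/(_ *m _) mulmxA -H.
  by rewrite state_transfer.
have step1 m : b m.+1 = alpha m * y m.
  by have /rowP/(_ 0) := step m; rewrite !mxE.
have step2 m : alpha m * y m.+1 = (x - nu m) * y m - b m.
  have /rowP/(_ 1) := step m; rewrite !mxE /= => ->.
  by rewrite mulrCA divff ?mulr1.
have Hp1 : b p = z' * b 0%N by have /rowP/(_ 0) := Hp; rewrite !mxE.
have Hp2 : y p = z' * y 0%N by have /rowP/(_ 1) := Hp; rewrite !mxE.
have left n : left_flow y n = b n.
  case: n => [|n] /=; last by rewrite step1.
  by rewrite -mulrA -step1 Hp1 mulrA zz' mul1r.
split=> [n hn|]; last by rewrite /flow_state left.
rewrite left; have -> : right_val y n = y n.+1.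
  rewrite /right_val; case: ltnP => // h.
  have -> : n = q by apply/eqP; rewrite eqn_leq h -ltnS hn.
  by rewrite Hp2.
by rewrite step2; ring.
Qed.

(** The matrix of the map that sends an eigenvector to its initial state. *)
Definition state0_mx : 'M[F]_(p, 2) :=
  \matrix_(i < p, j < 2)
    if j == 0 then z * alpha q *+ (i == ord_max) else (i == ord0)%:R.

Lemma mul_state0_mx (u : nat -> F) : (\row_(i < p) u i) *m state0_mx = flow_state u 0.
Proof.
apply/rowP => j; rewrite !mxE; under eq_bigr do rewrite !mxE.
case: (j == 0).
  rewrite (bigD1 ord_max) //= big1 ?addr0 => [|i /negbTE ni].
    by rewrite eqxx mulrC.
  by rewrite ni mulr0n mulr0.
rewrite (bigD1 ord0) //= big1 ?addr0 => [|i /negbTE ni]; last by rewrite ni mulr0.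
by rewrite mulr1.
Qed.

Definition seq_of_row (r : 'rV[F]_p) (n : nat) := r 0 (inord n).

Lemma row_inord (r : 'rV[F]_p) : r = \row_(i < p) seq_of_row r i.
Proof. by apply/rowP => i; rewrite mxE /seq_of_row inord_val. Qed.

(** A solution is determined by its initial state. *)
Lemma rank_mul_state0 x m (U : 'M[F]_(m, p)) : (U <= eigenspace jacobi x)%MS ->
  \rank (U *m state0_mx) = \rank U.
Proof.
move=> Ux; rewrite -(mxrank_mul_ker U state0_mx).
suff -> : (U :&: kermx state0_mx)%MS = 0 by rewrite mxrank0 addn0.
apply/eqP/rowV0P => r; rewrite sub_capmx => /andP[rU /sub_kermxP].
have /eigenspaceP := submx_trans rU Ux.
rewrite [r]row_inord mul_state0_mx => /is_eigenP rx r0.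
by apply/rowP => i; rewrite !mxE (flow_state_inj rx r0).
Qed.

Lemma state0_monodromy x m (U : 'M[F]_(m, p)) : (U <= eigenspace jacobi x)%MS ->
  U *m state0_mx *m monodromy x alpha nu 0 p = z' *: (U *m state0_mx).
Proof.
move=> Ux; apply/row_matrixP => i; rewrite linearZ /= !row_mul.
have /eigenspaceP := submx_trans (row_sub i U) Ux.
move: (row i U) => r; rewrite [r]row_inord mul_state0_mx => /is_eigenP rx.
by rewrite -flow_stateE // flow_state_period.
Qed.

(** The initial states of a two-dimensional eigenspace fill the plane, and each of
    them is multiplied by z'. *)
Lemma monodromy_scalar x : (1 < \rank (eigenspace jacobi x))%N ->
  monodromy x alpha nu 0 p = z'%:M.
Proof.
move=> rk; have full : row_full (eigenspace jacobi x *m state0_mx).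
  by rewrite /row_full eqn_leq rank_leq_col (rank_mul_state0 (submx_refl _)).
apply: (row_full_inj full).
by rewrite (state0_monodromy (submx_refl _)) mul_mx_scalar.
Qed.

Lemma monodromy_eigenvalue x : (0 < \rank (eigenspace jacobi x))%N ->
  (0 < \rank (eigenspace (monodromy x alpha nu 0 p) z'))%N.
Proof.
move=> rk; have sub : (eigenspace jacobi x *m state0_mx <=
   eigenspace (monodromy x alpha nu 0 p) z')%MS.
  by apply/eigenspaceP; rewrite (state0_monodromy (submx_refl _)).
by apply: leq_trans (mxrankS sub); rewrite (rank_mul_state0 (submx_refl _)).
Qed.

(** The orbits of the two basis states are independent eigenvectors. *)
Lemma scalar_monodromy_rank x : monodromy x alpha nu 0 p = z'%:M ->
  (1 < \rank (eigenspace jacobi x))%N.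
Proof.
move=> Mz; pose U : 'M[F]_(2, p) := \matrix_(i, n) monodromy x alpha nu 0 n i 1.
have rowU i : row i U = \row_(n < p) monodromy x alpha nu 0 n i 1.
  by apply/rowP => n; rewrite !mxE.
have orbit i n : state (monodromy x alpha nu 0 n i 0) (monodromy x alpha nu 0 n i 1) =
    state (monodromy x alpha nu 0 0 i 0) (monodromy x alpha nu 0 0 i 1) *m monodromy x alpha nu 0 n.
  have e m : state (monodromy x alpha nu 0 m i 0) (monodromy x alpha nu 0 m i 1) =
      row i (monodromy x alpha nu 0 m).
    by rewrite [RHS]state_eta !mxE.
  by rewrite !e -row_mul [monodromy x alpha nu 0 0]/monodromy big_geq // mul1mx.
have eig i : is_eigen x (fun n => monodromy x alpha nu 0 n i 1) /\
    flow_state (fun n => monodromy x alpha nu 0 n i 1) 0 = row i (monodromy x alpha nu 0 0).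
  rewrite [row _ _]state_eta !mxE.
  apply: (is_eigen_orbit (b := fun n => monodromy x alpha nu 0 n i 0)) => [n|].
    exact: orbit.
  by rewrite orbit Mz mul_mx_scalar.
have Ux : (U <= eigenspace jacobi x)%MS.
  apply/row_subP => i; apply/eigenspaceP; rewrite rowU.
  by apply/(is_eigenP x (fun n => monodromy x alpha nu 0 n i 1)); have [] := eig i.
apply: leq_trans (mxrankS Ux); rewrite -(rank_mul_state0 Ux).
suff -> : U *m state0_mx = 1%:M by rewrite mxrank1.
apply/row_matrixP => i; rewrite row_mul rowU.
rewrite (mul_state0_mx (fun n => monodromy x alpha nu 0 n i 1)).
by have [_ ->] := eig i; rewrite /monodromy big_geq.
Qed.
End PeriodicJacobi.

Section Powers.
Variables (F : fieldType) (M : 'M[F]_2).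

Lemma eigenspace_expr m (W : 'M[F]_(m, 2)) z k :
  (W <= eigenspace M z)%MS -> (W <= eigenspace (M ^+ k) (z ^+ k))%MS.
Proof.
move=> /eigenspaceP WM; apply/eigenspaceP.
elim: k => [|k IH]; first by rewrite !expr0 mulmx1 scale1r.
by rewrite !exprSr -[_ * M]/(_ *m M) mulmxA IH -scalemxAl WM scalerA.
Qed.

(** The two eigenlines span the plane, and M ^+ k acts on both by eps. *)
Lemma expr_scalar_of_eigen z z' k eps : z != z' ->
    (0 < \rank (eigenspace M z))%N -> (0 < \rank (eigenspace M z'))%N ->
    z ^+ k = eps -> z' ^+ k = eps ->
  M ^+ k = eps%:M.
Proof.
move=> zz' rz rz' ez ez'; pose w (b : bool) := if b then z else z'.
have winj : injective w by case=> [] [] // /eqP; rewrite /w ?(negbTE zz') // eq_sym (negbTE zz').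
have /mxdirectP /= dir := mxdirect_sum_eigenspace M (P := xpredT) (in2W winj).
have full : row_full (\sum_b eigenspace M (w b))%MS.
  rewrite /row_full eqn_leq rank_leq_col dir.
  rewrite (bigD1 true) //= (bigD1 false) //= big1 => [|[]] //.
  by rewrite addn0; move: rz rz'; rewrite /w; lia.
apply: (row_full_inj full); rewrite mul_mx_scalar; apply/eigenspaceP.
apply/sumsmx_subP => b _.
have -> : eps = w b ^+ k by case: b; rewrite /w.
exact: eigenspace_expr.
Qed.
End Powers.

(** The monodromy over one period of the shifted sequence is conjugate to the
    original one by the first transfer matrix, so that its k-th power is also the
    scalar eps. *)
Lemma shifted_repeat_monodromy (F : fieldType) (x eps : F)
    (alpha nu alpha' nu' : nat -> F) p k :
    (forall i, alpha i != 0) ->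
    (forall i, alpha (i + p)%N = alpha i) -> (forall i, nu (i + p)%N = nu i) ->
    (forall i, (i < k * p)%N -> alpha' i = alpha i /\ nu' i = nu i) ->
    (forall i, (k * p <= i < 2 * k * p)%N -> alpha' i = alpha i.+1 /\ nu' i = nu i.+1) ->
    monodromy x alpha nu 0 p ^+ k = eps%:M -> eps ^+ 2 = 1 ->
  monodromy x alpha' nu' 0 (2 * k * p) = 1%:M.
Proof.
move=> a0 pa pv lo hi Mk eps2; set l := (k * p)%N in lo hi *.
have l2 : (2 * k * p = l + l)%N by rewrite /l; lia.
have Ml := monodromy_periods x k pa pv.
have per (f : nat -> F) i : (forall i, f (i + p)%N = f i) -> f (i + l)%N = f i.
  move=> pf; rewrite /l; elim: (k) => [|j IHj]; first by rewrite addn0.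
  by rewrite mulSn addnCA addnC pf.
rewrite (@monodromy_cat _ _ _ _ _ l) //; last by rewrite l2 leq_addr.
have -> : monodromy x alpha' nu' 0 l = eps%:M.
  rewrite -Mk -Ml; apply: eq_big_nat => i hi'.
  by have [-> ->] := lo i hi'.
have -> : monodromy x alpha' nu' l (2 * k * p) = monodromy x alpha nu 1 l.+1.
  transitivity (\prod_(0 <= i < l) transfer x (alpha i.+1) (nu i.+1)).
    rewrite l2 /monodromy -{1}[l]add0n big_addn addnK; apply: eq_big_nat => i /andP[_ il].
    have [|-> ->] := hi (i + l)%N; first by rewrite leq_addl l2 ltn_add2r.
    by rewrite -addSn !per.
  by rewrite /monodromy big_add1.
have T0 : transfer x (alpha 0%N) (nu 0%N) \in unitmx.
  by rewrite unitmxE det_transfer ?unitr1.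
have -> : monodromy x alpha nu 1 l.+1 = eps%:M.
  apply: (row_full_inj (A := transfer x (alpha 0%N) (nu 0%N))).
    by rewrite row_full_unit.
  rewrite -{1}monodromy1 -[LHS]/(_ * _) -monodromy_cat //.
  rewrite (@monodromy_cat _ _ _ _ _ l) // monodromy1 Ml Mk -[LHS]/(_ *m _).
  by rewrite -scalar_mxC -[l]add0n !per.
by rewrite -[LHS]/(_ *m _) -scalar_mxM -expr2 eps2.
Qed.

(** * Closed gaps as double eigenvalues *)

Local Open Scope classical_set_scope.
Local Open Scope ring_scope.
Local Open Scope complex_scope.

Lemma set_maxE d (T : porderType d) (x0 m : T) (A : set T) :
  A m -> ubound A m -> set_max x0 A = m.
Proof.
move=> Am ub; apply: xget_unique => // y [Ay uby].
by apply/le_anti; rewrite ub // uby.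
Qed.

Lemma set_minE d (T : porderType d) (x0 m : T) (A : set T) :
  A m -> lbound A m -> set_min x0 A = m.
Proof.
move=> Am lb; apply: xget_unique => // y [Ay lby].
by apply/le_anti; rewrite lb // lby.
Qed.

Lemma sorted_double d (T : porderType d) (x0 x : T) (s : seq T) :
    sorted <=%O s -> (1 < count_mem x s)%N ->
  exists j, [/\ (j.+1 < size s)%N, nth x0 s j = x & nth x0 s j.+1 = x].
Proof.
elim: s => // y s IH /= srt; case: eqP => [yx|_] /=; last first.
  rewrite add0n => h; have [j [j1 j2 j3]] := IH (path_sorted srt) h.
  by exists j.+1.
rewrite add1n ltnS -has_count has_pred1; rewrite {y}yx in srt *.
case: s srt {IH} => // z s /= /andP[xz zs] xs; exists 0%N; split=> //=.
apply/le_anti; rewrite xz andbT; move: xs; rewrite inE => /orP[/eqP -> //|xs].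
by apply: (allP (order_path_min le_trans zs)).
Qed.

Lemma nth_double (T : eqType) (x0 x : T) (s : seq T) i j : (i < j < size s)%N ->
  nth x0 s i = x -> nth x0 s j = x -> (1 < count_mem x s)%N.
Proof.
elim: s i j => [|y s IH] i j; first by rewrite ltn0 andbF.
case: i j => [|i] [|j] //=.
  by move=> js -> sj; rewrite eqxx add1n ltnS -has_count has_pred1 -sj mem_nth.
move=> ij si sj; apply: leq_trans (IH i j ij si sj) _; exact: leq_addl.
Qed.

Lemma floquet_jacobi (R : realType) p (a v : 'rV[R]_p) theta (q : nat)
    (e : p = q.+1) (alpha nu : nat -> R) :
    (forall i, a 0 i = alpha i) -> (forall i, v 0 i = nu i) ->
  forall x, \rank (eigenspace (floquet a v theta) x) =
    \rank (eigenspace (jacobi q (fun i => (alpha i)%:C) (fun i => (nu i)%:C)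
               (expi theta) (expi (- theta))) x).
Proof.
case: _ / (esym e) in a v * => ea ev x.
have -> // : floquet a v theta = jacobi q (fun i => (alpha i)%:C)
    (fun i => (nu i)%:C) (expi theta) (expi (- theta)).
by apply: eq_mx => i j; rewrite !ea ev.
Qed.

Section Gaps.
Variable R : realType.
Notation C := (R[i]).
Variables (p : nat) (a v : 'rV[R]_p).
Hypothesis hp : (1 < p)%N.
Hypothesis a_gt0 : positive_vec a.

Definition coupling : R := 2 * \prod_i a 0 i.

Lemma coupling_gt0 : 0 < coupling.
Proof. by rewrite mulr_gt0 // prodr_gt0 // => i _; apply: a_gt0. Qed.

Definition angle (c : R) : R := acos (c / coupling) / (2 * pi).

(** The roots of P - c, where P is the polynomial of [floquet_char_poly], obtained
    as the spectrum of a Floquet matrix whose angle realises the level c. *)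
Definition levels (c : R) : seq R := eigenvals (floquet a v (angle c)).

Lemma cos_angle c : `|c| <= coupling -> coupling * cos (2 * pi * angle c) = c.
Proof.
move=> hc; rewrite /angle mulrC -[X in cos X]mulrC.
rewrite divfK ?mulf_neq0 ?lt0r_neq0 ?pi_gt0 //.
rewrite acosK ?divfK ?lt0r_neq0 ?coupling_gt0 //.
have K := coupling_gt0.
rewrite in_itv /= -ler_norml normrM normfV (gtr0_norm K).
by rewrite ler_pdivrMr // mul1r.
Qed.

Lemma norm_level theta : `|coupling * cos (2 * pi * theta)| <= coupling.
Proof.
have K := coupling_gt0; rewrite normrM (gtr0_norm K) -[leRHS]mulr1 ler_pM2l //.
by rewrite ler_norml cos_geN1 cos_le1.
Qed.

Lemma eigenvals_level theta :
  eigenvals (floquet a v theta) = levels (coupling * cos (2 * pi * theta)).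
Proof.
have [P PE] := floquet_char_poly a v hp.
rewrite /levels /eigenvals /spectrum !PE -/coupling.
by rewrite cos_angle ?norm_level.
Qed.

Lemma size_levels c : size (levels c) = p.
Proof. by have [] := hermitian_eigenvals (floquet_hermitian a v (angle c)). Qed.

Lemma sorted_levels c : sorted <=%R (levels c).
Proof. exact: sort_sorted le_total _. Qed.

Lemma count_eigenvals theta x :
  count_mem x (eigenvals (floquet a v theta)) = \rank (eigenspace (floquet a v theta) x%:C).
Proof. by have [_ _ ->] := hermitian_eigenvals (floquet_hermitian a v theta). Qed.

Lemma levels_fact : exists P : {poly R}, forall c, `|c| <= coupling ->
  P - c%:P = \prod_(z <- levels c) ('X - z%:P).
Proof.
have [P PE] := floquet_char_poly a v hp; exists P => c hc.
have [_ + _] := hermitian_eigenvals (floquet_hermitian a v (angle c)).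
rewrite PE -/coupling cos_angle // => /map_poly_inj; exact.
Qed.

Lemma expi_inv theta : expi theta * expi (- theta) = 1 :> C.
Proof.
rewrite /expi mulrN cosN sinN; simpc; rewrite -!expr2 cos2Dsin2.
by congr (_ +i* _); ring.
Qed.

Lemma expi_sqr1 theta : expi theta ^+ 2 = 1 :> C -> `|cos (2 * pi * theta)| = 1.
Proof.
rewrite /expi expr2; simpc => -[e _].
have := cos2Dsin2 (2 * pi * theta); rewrite !expr2 => e2.
have : `|cos (2 * pi * theta)| ^+ 2 = 1 by rewrite real_normK ?num_real // expr2; lra.
by move/eqP; rewrite sqrp_eq1 // => /eqP.
Qed.

Lemma extension (u : 'rV[R]_p) : exists f : nat -> R,
  (forall i, u 0 i = f i) /\ (forall i, f (i + p)%N = f i).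
Proof.
have p0 : (0 < p)%N by apply: ltnW.
exists (fun i => u 0 (Ordinal (ltn_pmod i p0))); split=> i; congr (u 0 _); apply: val_inj => /=.
  by rewrite modn_small.
by rewrite modnDr.
Qed.

Lemma extension_gt0 (alpha : nat -> R) :
    (forall i, a 0 i = alpha i) -> (forall i, alpha (i + p)%N = alpha i) ->
  forall i, 0 < alpha i.
Proof.
move=> ea pa i; have p0 : (0 < p)%N by apply: ltnW.
have -> : alpha i = alpha (i %% p)%N.
  rewrite {1}(divn_eq i p); elim: (i %/ p)%N => // n IH.
  by rewrite mulSn -addnA addnC pa.
by rewrite -(ea (Ordinal (ltn_pmod i p0))); apply: a_gt0.
Qed.

(** A monodromy has determinant 1, and the determinant of a scalar 2 x 2 matrix is
    the square of the scalar. *)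
Lemma double_monodromy theta x (alpha nu : nat -> R) :
    (forall i, a 0 i = alpha i) -> (forall i, v 0 i = nu i) ->
    (forall i, 0 < alpha i) ->
    (1 < count_mem x (eigenvals (floquet a v theta)))%N ->
  monodromy x%:C (fun i => (alpha i)%:C) (fun i => (nu i)%:C) 0 p =
    (expi (- theta))%:M /\ expi (- theta) ^+ 2 = 1 :> C.
Proof.
rewrite count_eigenvals => ea ev alpha_gt0.
have [q e] : {q | p = q.+1} by case: (p) hp => // q _; exists q.
rewrite (floquet_jacobi _ e ea ev) e.
have a0 i : (alpha i)%:C != 0 :> C by rewrite (inj_eq (@complexI R)) lt0r_neq0.
move=> rk; have M := monodromy_scalar a0 (expi_inv theta) rk; split=> //.
by have := det_monodromy x%:C (fun i => (nu i)%:C) 0 q.+1 a0; rewrite M det_scalar.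
Qed.

Lemma double_eigenvalue theta x : (1 < count_mem x (eigenvals (floquet a v theta)))%N ->
  `|cos (2 * pi * theta)| = 1.
Proof.
have [alpha [ea pa]] := extension a; have [nu [ev _]] := extension v.
move=> /(double_monodromy ea ev (extension_gt0 ea pa)) [_] /expi_sqr1.
by rewrite mulrN cosN.
Qed.

(** A double eigenvalue can only occur for cos (2 pi theta) = 1 or -1, that is, at
    the extreme levels. *)
Lemma uniq_levels c : `|c| < coupling -> uniq (levels c).
Proof.
move=> hc; apply/count_mem_uniq => x; apply/eqP.
have : (count_mem x (levels c) <= 1)%N.
  rewrite leqNgt; apply/negP => /double_eigenvalue e.
  move: (hc); rewrite -{1}(cos_angle (ltW hc)) normrM e mulr1 gtr0_norm ?coupling_gt0 //.
  by rewrite ltxx.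
by rewrite -has_pred1 has_count; case: (count _ _) => [|[]].
Qed.

Notation sgn j := (band_sign R p j).

Lemma sgnS j : (j.+1 < p)%N -> sgn j.+1 = - sgn j.
Proof.
move=> hj; rewrite /band_sign (_ : (p - j.+1 = (p - j.+2).+1)%N); last by lia.
by rewrite exprS mulN1r opprK.
Qed.

Lemma sgn_cases j : sgn j = 1 \/ sgn j = -1.
Proof. by rewrite /band_sign -signr_odd; case: (odd _); [right|left]. Qed.

(** The polynomial lemma on bands applies: the levels are real-rooted because the
    Floquet matrices are Hermitian. *)
Lemma levels_edges c j : `|c| <= coupling -> (j < p)%N ->
  (levels (- sgn j * coupling))`_j <= (levels c)`_j <= (levels (sgn j * coupling))`_j.
Proof.
have [P PE] := levels_fact; move=> hc hj.
apply: (band_edges coupling_gt0 _ _ _ PE) => //; first exact: ltnW.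
- by move=> *; apply: size_levels.
- by move=> *; apply: sorted_levels.
- exact: uniq_levels.
Qed.

Lemma edge_angle (e : R) : e = 1 \/ e = -1 ->
  exists2 theta : R, 0 <= theta <= 1 & cos (2 * pi * theta) = e.
Proof.
case=> ->; first by exists 0; rewrite ?mulr0 ?cos0 // lexx ler01.
exists 2^-1; first by apply/andP; split; lra.
by rewrite mulrAC divff ?mul1r ?cospi // pnatr_eq0.
Qed.

Lemma lambda_level j theta : lambda a v j theta = (levels (coupling * cos (2 * pi * theta)))`_j.
Proof. by rewrite /lambda eigenvals_level. Qed.

Lemma lambda_plusE j : (j < p)%N ->
  lambda_plus a v j = (levels (sgn j * coupling))`_j.
Proof.
move=> hj; have [theta th0 thE] := edge_angle (sgn_cases j).
apply: set_maxE => [|_ [t _ <-]].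
  exists theta; first by rewrite /= in_itv.
  by rewrite lambda_level thE mulrC.
by rewrite lambda_level; have /andP[_ h] := levels_edges (norm_level t) hj; exact: h.
Qed.

Lemma lambda_minusE j : (j < p)%N ->
  lambda_minus a v j = (levels (- sgn j * coupling))`_j.
Proof.
move=> hj; have sc : - sgn j = 1 \/ - sgn j = -1.
  by case: (sgn_cases j) => ->; rewrite ?opprK; [right|left].
have [theta th0 thE] := edge_angle sc.
apply: set_minE => [|_ [t _ <-]].
  exists theta; first by rewrite /= in_itv.
  by rewrite lambda_level thE mulrC.
by rewrite lambda_level; have /andP[h _] := levels_edges (norm_level t) hj; exact: h.
Qed.

(** The upper edge of the j-th band and the lower edge of the next one are
    consecutive roots of P at the same extreme level, so a closed gap is a double
    eigenvalue.  Conversely a double eigenvalue is a pair of equal consecutive roots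
    at an extreme level.  If it were the level of the other two edges of these bands,
    both bands would be reduced to x, which would be a root of P - c at every level c. *)
Lemma closed_gapP x : closed_gap a v x <->
  exists theta, (1 < count_mem x (eigenvals (floquet a v theta)))%N.
Proof.
split=> [[j [hj]]|[theta db]].
  rewrite (lambda_plusE (ltnW hj)) (lambda_minusE hj) (sgnS hj) opprK => e1 e2.
  have [theta _ thE] := edge_angle (sgn_cases j); exists theta.
  rewrite eigenvals_level thE [_ * sgn j]mulrC.
  apply: (@nth_double _ 0 _ _ j j.+1); [|exact: esym e1|exact: esym e2].
  by rewrite size_levels ltnSn.
have c1 := double_eigenvalue db; move: db; rewrite eigenvals_level => db.
have [j [hj xj xj1]] := sorted_double 0 (sorted_levels _) db.
rewrite size_levels in hj.
exists j; rewrite (lambda_plusE (ltnW hj)) (lambda_minusE hj) (sgnS hj) opprK.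
suff ec : cos (2 * pi * theta) = sgn j.
  by rewrite mulrC ec in xj xj1; split; [|exact: esym xj|exact: esym xj1].
have {c1} cc : cos (2 * pi * theta) = sgn j \/ cos (2 * pi * theta) = - sgn j.
  have : cos (2 * pi * theta) ^+ 2 == sgn j ^+ 2.
    by rewrite -[X in X == _]real_normK ?num_real // c1; case: (sgn_cases j) => ->; rewrite ?sqrrN expr1n.
  by rewrite eqf_sqr => /orP[] /eqP; [left|right].
(* The double eigenvalue sits at the outer edges: both bands collapse to x. *)
case: cc => [//|ec]; exfalso.
rewrite [_ * cos _]mulrC ec in xj xj1.
have all_c c : `|c| <= coupling -> (levels c)`_j = x.
  move=> hc; have /andP[lo _] := levels_edges hc (ltnW hj).
  have /andP[_ hi] := levels_edges hc hj.
  rewrite [leLHS]xj in lo; rewrite (sgnS hj) [leRHS]xj1 in hi.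
  apply/le_anti; rewrite lo andbT; apply: le_trans hi.
  by apply: (sorted_leq_nth le_trans le_refl) => //; rewrite ?sorted_levels ?inE ?size_levels // ltnW.
have [P PE] := levels_fact.
have Px c : `|c| <= coupling -> P.[x] = c.
  move=> hc; apply/eqP; rewrite -subr_eq0 -[c in X in X == _](hornerC c x).
  rewrite -hornerN -hornerD PE // -/(root _ x) root_prod_XsubC -(all_c c) //.
  by rewrite mem_nth // size_levels ltnW.
have K := coupling_gt0.
have P0 : P.[x] = 0 by apply: Px; rewrite normr0 ltW.
have PK : P.[x] = coupling by apply: Px; rewrite gtr0_norm.
by rewrite -PK P0 ltxx in K.
Qed.
End Gaps.

(** * Closed gaps of a repeated word *)

Section Expi.
Variable R : realType.
Notation C := (R[i]).

Lemma expiD (s t : R) : expi (s + t) = expi s * expi t :> C.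
Proof. by rewrite /expi mulrDr cosD sinD; simpc; congr (_ +i* _); rewrite addrC. Qed.

Lemma expi0 : expi 0 = 1 :> C.
Proof. by rewrite /expi mulr0 cos0 sin0. Qed.

Lemma expi_expr (t : R) n : expi t ^+ n = expi (t *+ n) :> C.
Proof. by elim: n => [|n IH]; rewrite ?expr0 ?mulr0n ?expi0 // exprS IH mulrS expiD. Qed.

Lemma expi_half : expi (2^-1 : R) = -1 :> C.
Proof. by rewrite /expi mulrAC divff ?mul1r ?cospi ?sinpi ?pnatr_eq0 //; simpc. Qed.

Lemma expi_Nhalf : expi (- 2^-1 : R) = -1 :> C.
Proof. by rewrite /expi mulrN mulrAC divff ?pnatr_eq0 // mul1r cosN sinN cospi sinpi; simpc. Qed.

Lemma bloch_angle (k j : nat) : (0 < k)%N ->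
  let theta : R := j%:R / (2 * k%:R) in
  expi theta ^+ k = (-1) ^+ j :> C /\ expi (- theta) ^+ k = (-1) ^+ j :> C.
Proof.
move=> k0 theta; have e : theta *+ k = 2^-1 *+ j.
  rewrite -[LHS]mulr_natr -[RHS]mulr_natr /theta; field.
  by rewrite pnatr_eq0 -lt0n.
by rewrite !expi_expr mulNrn e -mulNrn -!expi_expr expi_half expi_Nhalf.
Qed.

Lemma bloch_argument (k j : nat) : (0 < k)%N ->
  2 * pi * (j%:R / (2 * k%:R)) = pi * (j%:R / k%:R) :> R.
Proof. by move=> k0; field; rewrite pnatr_eq0 -lt0n. Qed.

Lemma bloch_argument_in (k j : nat) : (0 < j < k)%N -> 0 < pi * (j%:R / k%:R : R) < pi.
Proof.
case/andP=> j0 jk; have k0 := ltn_trans j0 jk.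
rewrite mulr_gt0 ?pi_gt0 ?divr_gt0 ?ltr0n //=.
by rewrite -[ltRHS]mulr1 ltr_pM2l ?pi_gt0 // ltr_pdivrMr ?ltr0n // mul1r ltr_nat.
Qed.

Lemma expi_neq_conj (t : R) : sin (2 * pi * t) != 0 -> expi t != expi (- t) :> C.
Proof.
move=> s0; apply/eqP; rewrite /expi mulrN cosN sinN => -[].
by move=> e; move: s0; rewrite (_ : sin _ = 0) ?eqxx //; lra.
Qed.

Lemma norm_cos_lt1 (t : R) : sin t != 0 -> `|cos t| < 1.
Proof.
move=> s0; rewrite -(@expr_lt1 _ 2) // real_normK ?num_real //.
by rewrite cos2sin2 ltrBlDr ltrDl exprn_even_gt0.
Qed.
End Expi.

Section GapTests.
Variable R : realType.
Notation C := (R[i]).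
Variables (p : nat) (a v : 'rV[R]_p) (alpha nu : nat -> R).
Hypothesis hp : (1 < p)%N.
Hypothesis alpha_gt0 : forall i, 0 < alpha i.
Hypothesis ea : forall i, a 0 i = alpha i.
Hypothesis ev : forall i, v 0 i = nu i.

Definition period_matrix (x : R) : 'M[C]_2 :=
  monodromy x%:C (fun i => (alpha i)%:C) (fun i => (nu i)%:C) 0 p.

Let a_gt0 : positive_vec a.
Proof. by move=> i; rewrite ea. Qed.

Let alphaC_neq0 i : (alpha i)%:C != 0 :> C.
Proof. by rewrite (inj_eq (@complexI R)) lt0r_neq0. Qed.

Let pE : {q | p = q.+1}.
Proof. by case: (p) hp => // q _; exists q. Qed.

Lemma closed_gap_of_period x : period_matrix x = 1%:M -> closed_gap a v x.
Proof.
move=> M; apply/(closed_gapP v hp a_gt0 x); exists 0; rewrite count_eigenvals.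
have [q e] := pE; rewrite (floquet_jacobi _ e ea ev).
apply: (scalar_monodromy_rank alphaC_neq0 (expi_inv 0)).
by rewrite oppr0 expi0 -e.
Qed.

Lemma period_of_closed_gap x : closed_gap a v x ->
  exists2 eps : C, period_matrix x = eps%:M & eps ^+ 2 = 1.
Proof.
move=> /(closed_gapP v hp a_gt0 x) [theta db].
have [M e] := double_monodromy hp ea ev alpha_gt0 db.
by exists (expi (- theta)).
Qed.

Lemma period_eigenvalue theta x : x \in eigenvals (floquet a v theta) ->
  (0 < \rank (eigenspace (period_matrix x) (expi (- theta))))%N.
Proof.
rewrite -has_pred1 has_count count_eigenvals.
have [q e] := pE; rewrite (floquet_jacobi _ e ea ev) /period_matrix e.
exact: (monodromy_eigenvalue alphaC_neq0 (expi_inv theta)).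
Qed.

(** At the level of cos (pi j / k) the angles theta and - theta, with
    theta = j / (2k), give the two distinct Floquet multipliers of x. *)
Lemma period_expr_level (k j : nat) x : (0 < j < k)%N ->
    x \in levels a v (coupling a * cos (pi * (j%:R / k%:R))) ->
  period_matrix x ^+ k = ((-1) ^+ j)%:M.
Proof.
move=> jk; have k0 : (0 < k)%N by case/andP: jk => _; apply: leq_ltn_trans.
rewrite -bloch_argument // => hx; set theta := j%:R / (2 * k%:R) in hx.
have [e1 e2] := bloch_angle R j k0.
apply: (expr_scalar_of_eigen (z := expi (- theta)) (z' := expi (- - theta))) => //.
- rewrite opprK eq_sym expi_neq_conj // bloch_argument //.
  by rewrite gt_eqF // sin_gt0_pi // bloch_argument_in.
- by apply: period_eigenvalue; rewrite (eigenvals_level v hp a_gt0).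
- apply: period_eigenvalue; rewrite (eigenvals_level v hp a_gt0) mulrN cosN.
  exact: hx.
- by rewrite opprK.
Qed.

(** The energies that become closed gaps when the period is repeated k times. *)
Definition bloch_levels (k : nat) : seq R :=
  [seq (levels a v (coupling a * cos (pi * (j%:R / k%:R))))`_i | j <- iota 1 k.-1, i <- iota 0 p].

Lemma size_bloch_levels k : size (bloch_levels k) = (k.-1 * p)%N.
Proof. by rewrite size_allpairs !size_iota. Qed.

Lemma bloch_level_lt k j : (0 < j < k)%N ->
  `|coupling a * cos (pi * (j%:R / k%:R))| < coupling a.
Proof.
move=> jk; have K := coupling_gt0 a_gt0.
rewrite normrM (gtr0_norm K) -[ltRHS]mulr1 ltr_pM2l // norm_cos_lt1 //.
by rewrite gt_eqF // sin_gt0_pi // bloch_argument_in.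
Qed.

Lemma bloch_levelsP k x : x \in bloch_levels k ->
  exists2 j, (0 < j < k)%N & x \in levels a v (coupling a * cos (pi * (j%:R / k%:R))).
Proof.
case/allpairsP => [[j i]] /= [hj hi ->]; exists j.
  by move: hj; rewrite mem_iota; lia.
by rewrite mem_nth // size_levels; move: hi; rewrite mem_iota.
Qed.

Lemma level_inj c c' x : `|c| <= coupling a -> `|c'| <= coupling a ->
  x \in levels a v c -> x \in levels a v c' -> c = c'.
Proof.
have [P PE] := levels_fact v hp a_gt0 => hc hc' hx hx'.
have e := mem_level PE x hc; rewrite hx in e.
have e' := mem_level PE x hc'; rewrite hx' in e'.
by rewrite -(eqP (esym e)) (eqP (esym e')).
Qed.

Lemma uniq_bloch_levels k : uniq (bloch_levels k).
Proof.
have K := coupling_gt0 a_gt0.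
apply: allpairs_uniq; rewrite ?iota_uniq //.
move=> _ _ /allpairsP[[j i] /= [hj hi ->]] /allpairsP[[j' i'] /= [hj' hi' ->]] /=.
rewrite !mem_iota /= add0n in hi hi'.
have {}hj : (0 < j < k)%N by move: hj; rewrite mem_iota; lia.
have {}hj' : (0 < j' < k)%N by move: hj'; rewrite mem_iota; lia.
have lt := bloch_level_lt hj; have lt' := bloch_level_lt hj'.
move=> e; have ec : cos (pi * (j%:R / k%:R)) = cos (pi * (j'%:R / k%:R)) :> R.
  apply: (mulfI (lt0r_neq0 K)).
  apply: (level_inj (ltW lt) (ltW lt') (x := (levels a v (coupling a * cos (pi * (j%:R / k%:R))))`_i)).
    by rewrite mem_nth ?size_levels.
  by rewrite e mem_nth ?size_levels.
have k0 : (0 < k)%N by lia.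
have ej : j = j'.
  have /(cos_inj _ _) := ec.
  rewrite !in_itv /=; have /andP[/ltW -> /ltW ->] := bloch_argument_in R hj.
  have /andP[/ltW -> /ltW ->] := bloch_argument_in R hj' => /(_ isT isT).
  move=> /(mulfI (lt0r_neq0 (pi_gt0 R))) /(mulIf _); rewrite invr_eq0 pnatr_eq0 -lt0n k0.
  by move=> /(_ isT) /eqP; rewrite eqr_nat => /eqP.
rewrite -{}ej in e *; congr (_, _); apply/eqP.
rewrite -(nth_uniq 0 _ _ (uniq_levels v hp a_gt0 lt)) ?size_levels //.
exact/eqP.
Qed.

Lemma bloch_level_open k x : x \in bloch_levels k -> ~ closed_gap a v x.
Proof.
case/bloch_levelsP => j jk xj /(closed_gapP v hp a_gt0 x) [theta db].
have c1 := double_eigenvalue hp a_gt0 db.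
have xt : x \in levels a v (coupling a * cos (2 * pi * theta)).
  by rewrite -(eigenvals_level v hp a_gt0) -has_pred1 has_count ltnW.
have lt := bloch_level_lt jk.
have ec := level_inj (norm_level a_gt0 theta) (ltW lt) xt xj.
by rewrite -ec normrM c1 mulr1 (gtr0_norm (coupling_gt0 a_gt0)) ltxx in lt.
Qed.

End GapTests.

Section Counting.
Variable R : realType.

Lemma finite_closed_gap p (a v : 'rV[R]_p) : finite_set [set x | closed_gap a v x].
Proof.
apply: (@sub_finite_set _ _ [set` [seq lambda_plus a v j | j <- iota 0 p]]); last first.
  exact: finite_seq.
move=> x [j [hj -> _]] /=; apply/mapP; exists j => //.
by rewrite mem_iota /= add0n ltnW.
Qed.

Lemma num_closed_gaps_le p (a v : 'rV[R]_p) : (num_closed_gaps a v <= p)%N.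
Proof.
rewrite /num_closed_gaps -[leqRHS](size_iota 0) -(size_map (lambda_plus a v)).
apply: uniq_leq_size => [|x]; first exact: fset_uniq.
rewrite in_fset_set ?inE; last exact: finite_closed_gap.
by case=> j [hj -> _]; rewrite map_f // mem_iota /= add0n ltnW.
Qed.

Lemma num_closed_gaps_ge p (a v : 'rV[R]_p) (s : seq R) : uniq s ->
  {in s, forall x, closed_gap a v x} -> (size s <= num_closed_gaps a v)%N.
Proof.
move=> us sub; apply: uniq_leq_size => // x xs.
by rewrite in_fset_set ?inE; [exact: sub|exact: finite_closed_gap].
Qed.

Definition shifted_repeat T (l : nat) (f : nat -> T) (n : nat) : T :=
  if (n < l)%N then f n else f n.+1.

(** The k-th power of the monodromy is a scalar of square 1 at the closed gaps of
    (a, v) and at the (k - 1) p energies [bloch_levels], which are not closed gaps of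
    (a, v). *)
Lemma num_closed_gaps_shifted_repeat p k (a v : 'rV[R]_p) (a' v' : 'rV[R]_(2 * k * p))
    (alpha nu : nat -> R) :
    (1 < p)%N -> (1 < k)%N -> (forall i, 0 < alpha i) ->
    (forall i, alpha (i + p)%N = alpha i) -> (forall i, nu (i + p)%N = nu i) ->
    (forall i, a 0 i = alpha i) -> (forall i, v 0 i = nu i) ->
    (forall i, a' 0 i = shifted_repeat (k * p) alpha i) ->
    (forall i, v' 0 i = shifted_repeat (k * p) nu i) ->
  (num_closed_gaps a v + (k - 1) * p <= num_closed_gaps a' v')%N.
Proof.
move=> hp hk alpha_gt0 pa pv ea ev ea' ev'.
have hq : (1 < 2 * k * p)%N by nia.
have gap_of x eps : period_matrix p alpha nu x ^+ k = eps%:M -> eps ^+ 2 = 1 -> closed_gap a' v' x.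
  move=> M e; apply: (closed_gap_of_period hq _ ea' ev') => [i|].
    by rewrite /shifted_repeat; case: ifP.
  apply: (shifted_repeat_monodromy _ _ _ _ _ M e).
  - by move=> i; rewrite (inj_eq (@complexI R)) lt0r_neq0.
  - by move=> i /=; rewrite pa.
  - by move=> i /=; rewrite pv.
  - by move=> i hi; rewrite /shifted_repeat hi.
  - by move=> i /andP[hi _]; rewrite /shifted_repeat ltnNge hi.
set S := fset_set [set x | closed_gap a v x].
have Sgap x : x \in S -> closed_gap a v x.
  by rewrite in_fset_set ?inE //; exact: finite_closed_gap.
rewrite subn1 -(size_bloch_levels a v k) -size_cat.
apply: num_closed_gaps_ge => [|x].
  rewrite cat_uniq fset_uniq (uniq_bloch_levels v hp alpha_gt0 ea) andbT /=.
  apply/hasPn => x /(bloch_level_open hp alpha_gt0 ea) op.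
  by apply/negP => /Sgap.
rewrite mem_cat => /orP[/Sgap|].
  move=> /(period_of_closed_gap hp alpha_gt0 ea ev) [eps M e].
  apply: (gap_of x (eps ^+ k)); last by rewrite -exprM mulnC exprM e expr1n.
  by rewrite M -rmorphXn.
case/(bloch_levelsP hp) => j jk /(period_expr_level hp alpha_gt0 ea ev jk) M.
by apply: gap_of M _; rewrite -exprM mulnC exprM sqrrN !expr1n.
Qed.
End Counting.

(** * Irreducibility of the repeated word *)

(** The bound provides a greatest element, and [set_max] can only select that one. *)
Lemma nat_set_maxP (A : set nat) m0 b : A m0 -> (forall m, A m -> (m <= b)%N) ->
  A (set_max 0%N A) /\ forall m, A m -> (m <= set_max 0%N A)%N.
Proof.
move=> Am0 Ab.
have ex : exists m, `[< A m >] by exists m0; apply/asboolP.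
have bd m : `[< A m >] -> (m <= b)%N by move=> /asboolP; exact: Ab.
case: (ex_maxnP ex bd) => m /asboolP Am mx.
have -> : set_max 0%N A = m.
  by apply: set_maxE => // i Ai; rewrite leEnat; apply: mx; apply/asboolP.
by split=> // i Ai; apply: mx; apply/asboolP.
Qed.

Section Periodic.
Variables (T : Type) (p : nat) (f : nat -> T).
Hypothesis p_gt0 : (0 < p)%N.
Hypothesis pf : forall i, f (i + p)%N = f i.

Lemma periodic_mod i : f (i %% p)%N = f i.
Proof.
rewrite {2}(divn_eq i p); elim: (i %/ p)%N => // n IH.
by rewrite mulSn -addnA addnC pf.
Qed.

Lemma periodic_eqmod i j : i = j %[mod p] -> f i = f j.
Proof. by rewrite -periodic_mod => ->; rewrite periodic_mod. Qed.

(** One period determines a periodic sequence. *)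
Lemma period_of_window m d e :
    (forall n, (m <= n < m + p)%N -> f (n + d)%N = f (n + e)%N) ->
  forall n, f (n + d)%N = f (n + e)%N.
Proof.
move=> H n; pose n' := (m + (n + m * p.-1) %% p)%N.
have e' : n' = n %[mod p].
  rewrite /n' modnDmr addnCA -mulnS prednK //.
  by rewrite addnC modnMDl.
have c t : f (n + t)%N = f (n' + t)%N.
  by apply: periodic_eqmod; rewrite -(modnDml n) -(modnDml n') e'.
by rewrite !c H // /n' leq_addr ltn_add2l ltn_mod.
Qed.

End Periodic.

Definition least_period (T : Type) (p : nat) (f : nat -> T) :=
  forall d, (forall n, f (n + d)%N = f n) -> (p %| d)%N.

Section ShiftedRepeat.
Variables (T : Type) (p k : nat) (f : nat -> T).
Hypothesis hp : (1 < p)%N.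
Hypothesis hk : (1 < k)%N.
Hypothesis pf : forall i, f (i + p)%N = f i.
Hypothesis irr : least_period p f.

Let g n := shifted_repeat (k * p) f (n %% (2 * k * p)).
Let p_gt0 : (0 < p)%N := ltnW hp.
Let q_gt0 : (0 < 2 * k * p)%N.
Proof. by rewrite !muln_gt0 /= p_gt0 andbT ltnW. Qed.

Let g1 n : (n < k * p)%N -> g n = f n.
Proof.
by move=> h; rewrite /g modn_small ?/shifted_repeat ?h //; lia.
Qed.

Let g2 n : (k * p <= n < 2 * k * p)%N -> g n = f n.+1.
Proof.
move=> /andP[h1 h2]; rewrite /g modn_small // /shifted_repeat ltnNge h1 //.
Qed.

Let g3 n : (2 * k * p <= n < 2 * k * p + k * p)%N -> g n = f n.
Proof.
move=> /andP[h1 h2]; rewrite /g -{1}(subnK h1) modnDr modn_small; last by lia.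
rewrite /shifted_repeat ifT; last by lia.
apply: (periodic_eqmod pf); rewrite -{2}(subnK h1) addnC.
by rewrite modnMDl.
Qed.

(** Compare g with its translate by d.  Inside the first half this makes d a
    period of f when d <= (k - 1) p; across the junction in the middle it makes d + 1
    one as soon as d >= p; and across the junction at the end it makes d - 1 one when
    d > (k - 1) p.  The divisibilities obtained leave only p = 2 and d odd, where
    f 0 = f 1 gives a contradiction. *)
Lemma shifted_repeat_no_small_period d : (0 < d <= k * p)%N ->
  (forall n, g (n + d)%N = g n) -> False.
Proof.
case/andP=> d0 dl gd.
have hkp : (2 * p <= k * p)%N by rewrite leq_mul2r hk orbT.
have d_small : (d <= k.-1 * p)%N -> (p %| d)%N.
  move=> dk; apply: irr => n; rewrite -[in RHS](addn0 n).
  apply: (period_of_window p_gt0 pf (m := 0)) => i /andP[_ hi].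
  have e : (k * p = k.-1 * p + p)%N by rewrite -{1}(ltn_predK hk) mulSn addnC.
  by rewrite addn0 -g1 ?gd ?g1 //; lia.
have ge_p : (p <= d)%N.
  rewrite leqNgt; apply/negP => dp.
  have /d_small /dvdn_leq : (d <= k.-1 * p)%N.
    apply: leq_trans (ltnW dp) _; rewrite leq_pmull // -ltnS.
    by rewrite (ltn_predK hk).
  by move=> /(_ d0); rewrite leqNgt dp.
have d1 : (p %| d.+1)%N.
  apply: irr => n; rewrite -[in RHS](addn0 n).
  apply: (period_of_window p_gt0 pf (m := k * p - d)) => i hi.
  rewrite addn0 addnS -g2; last by lia.
  by rewrite gd g1 //; lia.
case: (leqP d (k.-1 * p)) => [/d_small d2|dk].
  have := dvdn_sub d1 d2; rewrite subSnn dvdn1 => /eqP e.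
  by have := hp; rewrite e.
have d3 : (p %| d.-1)%N.
  apply: irr => n; rewrite -[in RHS](addn0 n).
  apply: (period_of_window p_gt0 pf (m := (2 * k * p - d).+1)) => -[|i] hi.
    by lia.
  rewrite addn0 -(g2 (n := i)); last by lia.
  by rewrite -gd g3; [congr f; lia|lia].
have p2 : p = 2%N.
  apply/eqP; rewrite eqn_leq hp andbT; apply: dvdn_leq => //.
  have := dvdn_sub d1 d3; rewrite (_ : (d.+1 - d.-1)%N = 2%N) //; lia.
have odd_d : odd d.
  by move: d1; rewrite p2 dvdn2 /= negbK.
have d_lt : (d < k * p)%N.
  rewrite ltn_neqAle dl andbT; apply: contraTneq odd_d => ->.
  by rewrite oddM p2 andbF.
suff : (p %| 1)%N by rewrite dvdn1 => /eqP e; have := hp; rewrite e.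
apply: irr => n; rewrite -[in RHS](addn0 n).
have f01 : f 1%N = f 0%N.
  rewrite -(g1 (n := 0)); last by lia.
  rewrite -gd g1 //; apply: (periodic_eqmod pf).
  by rewrite p2 !modn2 odd_d.
apply: (period_of_window p_gt0 pf (m := 0)) => -[|[|i]] hi; first exact: f01.
  by have := pf 0; rewrite p2 add1n addn0 f01.
by lia.
Qed.

Lemma least_period_shifted_repeat : least_period (2 * k * p) g.
Proof.
move=> d gd; rewrite /dvdn; set e := (d %% _)%N.
have he : (e < 2 * k * p)%N by rewrite ltn_mod.
have pg n : g (n + 2 * k * p)%N = g n by rewrite /g modnDr.
have ge n : g (n + e)%N = g n.
  by rewrite -[RHS]gd; apply: (periodic_eqmod pg); rewrite modnDmr.
case: (posnP e) => [//|e0]; exfalso.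
case: (leqP e (k * p)) => [el|el].
  by apply: (shifted_repeat_no_small_period (d := e)); rewrite ?e0.
apply: (shifted_repeat_no_small_period (d := 2 * k * p - e)) => [|n]; first by lia.
by rewrite -ge -addnA subnK ?pg // ltnW.
Qed.

End ShiftedRepeat.

Section Cyc.
Variables (R : realType) (p : nat) (v : 'rV[R]_p) (f : nat -> R).
Hypothesis p_gt0 : (0 < p)%N.
Hypothesis ev : forall i, v 0 i = f i.
Hypothesis pf : forall i, f (i + p)%N = f i.

Lemma iter_cycE m i : iter m (@cyc R p) v 0 i = f (i + m)%N.
Proof.
elim: m i => [|m IH] i; first by rewrite addn0 ev.
rewrite iterS mxE IH /=; apply: (periodic_eqmod pf).
by rewrite modnDml addnS addSn.
Qed.

Lemma irreducible_least_period : irreducible_vec v <-> least_period p f.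
Proof.
split=> [irr d fd|irr].
  pose i := Ordinal (ltn_pmod d p_gt0); pose z := Ordinal p_gt0.
  suff /(congr1 val) /= : i = z by move/eqP.
  apply: irr; apply/rowP => j; rewrite !iter_cycE /= addn0 -[RHS]fd.
  by apply: (periodic_eqmod pf); rewrite modnDmr.
move=> i j; wlog ij : i j / (i <= j)%N.
  by move=> W e; case: (leqP i j) => [|/ltnW] h; [apply: W|apply/esym/W].
move=> e; have fij : forall n, f (n + i)%N = f (n + j)%N.
  apply: (period_of_window p_gt0 pf (m := 0)) => n /andP[_ hn].
  by have /rowP/(_ (Ordinal hn)) := e; rewrite !iter_cycE.
have /irr : forall n, f (n + (j - i))%N = f n.
  move=> n; have c t : f t = f (t + p.-1 * i + i)%N.
    apply: (periodic_eqmod pf).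
    rewrite -addnA -mulSnr prednK // mulnC addnC; by rewrite modnMDl.
  rewrite (c n) fij [LHS]c; congr f; lia.
rewrite /dvdn modn_small; last by apply: leq_ltn_trans (leq_subr _ _) (ltn_ord j).
by rewrite subn_eq0 => ji; apply/val_inj/eqP; rewrite eqn_leq ij.
Qed.
End Cyc.

Section Maxima.
Variable R : realType.

(** Needed for the maximum over irreducible vectors to be attained; the bound c
    makes the vector positive when required. *)
Lemma irreducible_exists p (c : R) : (1 < p)%N ->
  exists2 v : 'rV[R]_p, irreducible_vec v & forall i, c <= v 0 i.
Proof.
move=> hp; pose f n : R := c + (n %% p == 0)%N%:R.
exists (\row_i f i) => [|i]; last by rewrite mxE lerDl.
apply/(irreducible_least_period (f := f) (ltnW hp)) => [i|i|d fd].
- by rewrite mxE.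
- by rewrite /f modnDr.
have := fd 0%N; rewrite /f add0n mod0n eqxx => /addrI /eqP.
by rewrite eqr_nat /dvdn; case: (d %% p == 0)%N.
Qed.

Lemma irreducible_shifted_repeat p k (f : nat -> R) :
    (1 < p)%N -> (1 < k)%N -> (forall i, f (i + p)%N = f i) -> least_period p f ->
  irreducible_vec (\row_(i < 2 * k * p) shifted_repeat (k * p) f i).
Proof.
move=> hp hk pf irr; have q0 : (0 < 2 * k * p)%N by nia.
apply/(irreducible_least_period (f := fun n => shifted_repeat (k * p) f (n %% (2 * k * p))) q0) => [i|i|].
- by rewrite mxE modn_small.
- by rewrite modnDr.
exact: least_period_shifted_repeat.
Qed.

Lemma shifted_repeat_const T l (c : T) n : shifted_repeat l (fun _ => c) n = c.
Proof. by rewrite /shifted_repeat if_same. Qed.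

Lemma max_gDSO_ge p k : (1 < p)%N -> (1 < k)%N ->
  (max_gDSO R p + (k - 1) * p <= max_gDSO R (2 * k * p))%N.
Proof.
move=> hp hk; have [v0 irr0 _] := irreducible_exists 0 hp.
have [|m /= [v _ <-]|[v irr vE] _] := @nat_set_maxP
    [set gDSO v | v in [set v : 'rV[R]_p | irreducible_vec v]] (gDSO v0) p.
- by exists v0.
- exact: num_closed_gaps_le.
rewrite /max_gDSO -vE.
have [f [ef pf]] := extension hp v.
set w := \row_(i < 2 * k * p) shifted_repeat (k * p) f i.
have irrw : irreducible_vec w.
  apply: irreducible_shifted_repeat => //.
  exact/(irreducible_least_period (ltnW hp) ef pf).
apply: (@leq_trans (gDSO w)).
  apply: (num_closed_gaps_shifted_repeat (alpha := fun _ => 1) (nu := f)) => //.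
  - by move=> i; rewrite mxE.
  - by move=> i; rewrite mxE shifted_repeat_const.
  - by move=> i; rewrite mxE.
have [|m /= [u _ <-]|_] := @nat_set_maxP
    [set gDSO v | v in [set v : 'rV[R]_(2 * k * p) | irreducible_vec v]] (gDSO w) (2 * k * p).
- by exists w.
- exact: num_closed_gaps_le.
by apply; exists w.
Qed.

Lemma max_gODJM_ge p k : (1 < p)%N -> (1 < k)%N ->
  (max_gODJM R p + (k - 1) * p <= max_gODJM R (2 * k * p))%N.
Proof.
move=> hp hk; have [a0 irr0 pos0] := irreducible_exists 1 hp.
have [|m /= [a _ <-]|[a [pos irr] aE] _] := @nat_set_maxP
    [set gODJM a | a in [set a : 'rV[R]_p | positive_vec a /\ irreducible_vec a]] (gODJM a0) p.
- by exists a0; split=> // i; apply: lt_le_trans (pos0 i).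
- exact: num_closed_gaps_le.
rewrite /max_gODJM -aE.
have [f [ef pf]] := extension hp a.
have f_gt0 := extension_gt0 hp pos ef pf.
set w := \row_(i < 2 * k * p) shifted_repeat (k * p) f i.
have ww : positive_vec w /\ irreducible_vec w.
  split; first by move=> i; rewrite mxE /shifted_repeat; case: ifP.
  apply: irreducible_shifted_repeat => //.
  exact/(irreducible_least_period (ltnW hp) ef pf).
apply: (@leq_trans (gODJM w)).
  apply: (num_closed_gaps_shifted_repeat (alpha := f) (nu := fun _ => 0)) => //.
  - by move=> i; rewrite mxE.
  - by move=> i; rewrite mxE.
  - by move=> i; rewrite mxE shifted_repeat_const.
have [|m /= [u _ <-]|_] := @nat_set_maxP
    [set gODJM a | a in [set a : 'rV[R]_(2 * k * p) | positive_vec a /\ irreducible_vec a]] (gODJM w) (2 * k * p).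
- by exists w.
- exact: num_closed_gaps_le.
by apply; exists w.
Qed.
End Maxima.

Theorem theorem1p4 (R : realType) (p k : nat) (hp : (2 <= p)%N) (hk : (2 <= k)%N) :
  (max_gDSO R p + (k - 1) * p <= max_gDSO R (2 * k * p))%N /\
  (max_gODJM R p + (k - 1) * p <= max_gODJM R (2 * k * p))%N.
Proof. by split; [apply: max_gDSO_ge|apply: max_gODJM_ge]. Qed.
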